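(* Let $T=[0,t_1]$ with $0<t_1<\infty$, let $U\subset\mathbb{R}^p$, and let $f:T\times\mathbb{R}^n\times U\to\mathbb{R}^n$, $L_r:T\times\mathbb{R}^n\times U\to\mathbb{R}$, $L_{mx}:T\times\mathbb{R}^n\to\mathbb{R}$, $\Psi:\mathbb{R}^n\to\mathbb{R}$. Fix $x_0\in\mathbb{R}^n$. Assume: (A.0) $U$ is compact. (A.1) $f$ is continuous and there is $K_f>0$ such that for all $(s,u)\in T\times U$: $|f(s,x,u)-f(s,x',u)|\le K_f|x-x'|$ for all $x,x'\in\mathbb{R}^n$, and $|f(s,x,u)|\le K_f(1+|x|)$ for all $x\in\mathbb{R}^n$. (A.2) $L_r$, $L_{mx}$ and $\Psi$ are continuous, and there is $K_L<\infty$ such that $|L_{mx}(s,x)-L_{mx}(s,x')|\le K_L|x-x'|$ for all $s\in T$, $x,x'\in\mathbb{R}^n$. (A.3) $L_{mx}$ is continuously differentiable and, with $\Delta_{mx}(s,x,u):=\frac{\partial L_{mx}(s,x)}{\partial s}+\frac{\partial L_{mx}(s,x)}{\partial x}f(s,x,u)$, there is $K_\Delta>0$ such that for all $(s,u)\in T\times U$: $|\Delta_{mx}(s,x,u)-\Delta_{mx}(s,x',u)|\le K_\Delta|x-x'|$ for all $x,x'\in\mathbb{R}^n$, and $|\Delta_{mx}(s,x,u)|\le K_\Delta(1+|x|)$ for all $x\in\mathbb{R}^n$. (A.4) For each $(s,x)\in T\times\mathbb{R}^n$ the set $f(s,x,U):=\{f(s,x,u):u\in U\}$ is convex. (A.5)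 There is $K_r>0$ such that for all $(s,u)\in T\times U$: $|L_r(s,x,u)-L_r(s,x',u)|\le K_r|x-x'|$ for all $x,x'\in\mathbb{R}^n$, and $|L_r(s,x,u)|\le K_r(1+|x|)$ for all $x\in\mathbb{R}^n$. Let $\delta_n>0$ with $\delta_n\to0$, and for each $n$ let $\boldsymbol u^*_n\in\mathcal{U}$ be a pure control that is optimal for the smooth problem with parameter $\delta_n$, both among pure controls and among relaxed controls, i.e. $\Gamma(\boldsymbol u_n^*,\delta_n)=\sup_{\boldsymbol u\in\mathcal{U}}\Gamma(\boldsymbol u,\delta_n)=\sup_{\boldsymbol\sigma\in\mathcal{S}}\Gamma(\boldsymbol\sigma,\delta_n)$. Then $$\lim_{n\to\infty}\big|\Gamma(\boldsymbol u^*_n,0)-\Gamma^*(0)\big|=0,$$ where $\Gamma(\boldsymbol u^*_n,0)=J(x_0;\boldsymbol u_n^* )$ with $$J(x_0;\boldsymbol u)=\int_0^{t_1}L_r(s,x(s),u(s))\,ds+\Psi(x(t_1))-\sup_{s\in T}L_{mx}(s,x(s)),\quad \dot x(s)=f(s,x(s),u(s)),\ x(0)=x_0,$$ and $\Gamma^*(0)=\sup_{\boldsymbol\sigma\in\mathcal{S}}\Gamma(\boldsymbol\sigma,0)$ is the corresponding value.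
   Context: $|\cdot|$ is the Euclidean norm and $a^+=\max\{a,0\}$. $\phi:[0,1]\to[0,1]$ is a fixed Lipschitz continuous increasing function with $\phi(0)=0$, $\phi(1)=1$, and for $\delta>0$: $\psi_\delta(d):=\phi(1+d/\delta)$ if $d\in[-\delta,0]$, $\psi_\delta(d):=1$ if $d>0$, $\psi_\delta(d):=0$ if $d<-\delta$. $\mathcal{P}(U)$ is the space of (Borel) probability measures on $U$ with the topology of weak convergence. $\mathcal{S}$ is the set of relaxed controls, i.e. Lebesgue measurable maps $\boldsymbol\sigma:T\to\mathcal{P}(U)$, $t\mapsto\sigma(t)=\sigma(t,\cdot)$. $\mathcal{U}$ is the set of measurable functions $\boldsymbol u:T\to U$ (pure controls), regarded as a subset of $\mathcal{S}$ by identifying $\boldsymbol u$ with $t\mapsto\delta_{u(t)}$ (Dirac measure). For $\boldsymbol\sigma\in\mathcal{S}$, $\boldsymbol x_{\boldsymbol\sigma}$ is the unique solution of $\dot x(s)=\int_U f(s,x(s),u)\,\sigma(s,du)$, $x(0)=x_0$. For $\delta>0$, $\boldsymbol y^\delta_{\boldsymbol\sigma}$ is the unique solution of $$\dot y(s)=\psi_\delta\big(L_{mx}(s,x_{\boldsymbol\sigma}(s))-y(s)\big)\int_U\big(\Delta_{mx}(s,x_{\boldsymbol\sigma}(s),u)\big)^+\sigma(s,du),\qquad y(0)=L_{mx}(0,x_0),$$ and for $\delta=0$, $y^0_{\boldsymbol\sigma}(t):=\sup_{s\in[0,t]}L_{mx}(s,x_{\boldsymbol\sigma}(s))$. (Differential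 equations are understood in integral form.) For $\boldsymbol\sigma\in\mathcal{S}$ and $\delta\ge0$, $$\Gamma(\boldsymbol\sigma,\delta):=\int_0^{t_1}\int_U L_r(t,x_{\boldsymbol\sigma}(t),u)\,\sigma(t,du)\,dt+\Psi(x_{\boldsymbol\sigma}(t_1))-y^\delta_{\boldsymbol\sigma}(t_1),\qquad \Gamma^*(\delta):=\sup_{\boldsymbol\sigma\in\mathcal{S}}\Gamma(\boldsymbol\sigma,\delta).$$ The smooth problem with parameter $\delta>0$ is the maximization of $\Gamma(\cdot,\delta)$. *)

(* Defs.v *)
From HB Require Import structures.
From mathcomp Require Import all_boot all_order all_algebra.
From mathcomp Require Import all_classical all_reals all_analysis.

Set Implicit Arguments.
Unset Strict Implicit.
Unset Printing Implicit Defensive.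
Import Order.TTheory GRing.Theory Num.Theory.
Import numFieldNormedType.Exports.

Local Open Scope classical_set_scope.
Local Open Scope ring_scope.

(* Functions given on T x R^n, T x R^n x U or T, with T = [0, t1], are total
   functions here; only their values on these sets are used. *)

(* The canonical norm of 'rV[R]_n is the sup norm; it induces the same topology
   as the Euclidean norm. *)
Definition enorm (R : realType) (n : nat) (v : 'rV[R]_n) : R :=
  Num.sqrt (\sum_(i < n) v 0 i ^+ 2).

(* R with the sigma-algebra of Lebesgue (not only Borel) measurable sets. *)
Definition lebesgueType (R : realType) : measurableType _ :=
  caratheodory_type
    (((wlength (idfun : R -> R)) : set (ocitv_type R) -> \bar R)^*)%mu.

Definition borelType (R : realType) (p : nat) : measurableType _ :=
  g_sigma_algebraType (@open 'rV[R]_p).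

Definition phi_admissible (R : realType) (phi : R -> R) : Prop :=
  [/\ (forall a, a \in `[0, 1] -> phi a \in `[0, 1]),
      phi 0 = 0,
      phi 1 = 1,
      {in `[0, 1] &, {homo phi : a b / a <= b}} &
      [lipschitz phi a | a in `[0, 1]%classic]].

Definition psi (R : realType) (phi : R -> R) (delta d : R) : R :=
  if 0 < d then 1 else if d < - delta then 0 else phi (1 + d / delta).

Section relaxed_controls.
Context {R : realType} {p : nat}.
Implicit Types U : set 'rV[R]_p.

(* Borel probability measures on U, as the Borel probability measures on R^p
   that give U mass 1. *)
Definition Prob U : Type :=
  set_type [set mu : probability (borelType R p) R | mu U = 1%E].

Definition prob_val U (mu : Prob U) : probability (borelType R p) R :=
  set_val mu.

Definition bounded_continuous_on U : set ('rV[R]_p -> R) :=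
  [set g | {within U, continuous g} /\ [bounded g v | v in U]].

Definition weak_ev U (mu : Prob U) :
    {ptws set_type (bounded_continuous_on U) -> R} :=
  fun g => \int[prob_val mu]_(v in U) (set_val g) v.

(* The coarsest topology making mu |-> \int g dmu continuous for every bounded
   continuous g : U -> R. *)
Definition weak_open U : set (set (Prob U)) :=
  @open (initial_topology (@weak_ev U)).

Lemma prob_dirac_subproof U (v : U) :
  [set mu : probability (borelType R p) R | mu U = 1%E]
    (@dirac _ (borelType R p) (set_val v) R).
Proof. by rewrite /= diracE (valP v). Qed.

Definition prob_dirac U (v : U) : Prob U :=
  SigSub (mem_set (prob_dirac_subproof v)).

Definition relaxed_controls (t1 : R) U : set (R -> Prob U) :=
  [set sigma | forall B : set (Prob U), <<s @weak_open U >> B ->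
     measurable ((`[0, t1] `&` sigma @^-1` B) : set (lebesgueType R))].

Definition pure_controls (t1 : R) U : set (R -> U) :=
  [set u | measurable_fun (`[0, t1] : set (lebesgueType R))
             (fun t : R => set_val (u t) : borelType R p)].

Definition dirac_control U (u : R -> U) : R -> Prob U :=
  fun t => prob_dirac (u t).

End relaxed_controls.
Arguments relaxed_controls {R p} t1 U.
Arguments pure_controls {R p} t1 U.

Section partial_derivatives.
Context {R : realType} {n : nat}.
Variables (t1 : R) (L : R -> 'rV[R]_n -> R).

(* The increment h is restricted to s + h in [0, t1], so that the derivative in
   time is one-sided at 0 and t1. *)
Definition time_increments (s : R) : set_system R :=
  within [set h : R | s + h \in `[0, t1]] 0^'.

Definition time_quotient (s : R) (x : 'rV[R]_n) (h : R) : R :=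
  h^-1 * (L (s + h) x - L s x).

Definition partial_time (s : R) (x : 'rV[R]_n) : R :=
  lim (time_quotient s x @ time_increments s).

Definition partial_space (i : 'I_n) (s : R) (x : 'rV[R]_n) : R :=
  'D_(delta_mx 0 i) (L s) x.

Definition continuously_differentiable : Prop :=
  [/\ (forall (s : R) x, s \in `[0, t1] ->
         cvg (time_quotient s x @ time_increments s)),
      (forall i (s : R) x, s \in `[0, t1] -> derivable (L s) x (delta_mx 0 i)),
      {within `[0, t1] `*` setT,
        continuous (fun z : R * 'rV[R]_n => partial_time z.1 z.2)} &
      (forall i, {within `[0, t1] `*` setT,
         continuous (fun z : R * 'rV[R]_n => partial_space i z.1 z.2)})].

End partial_derivatives.

Section control_problem.
Context {R : realType} {n p : nat}.
Variables (t1 : R) (U : set 'rV[R]_p).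
Variable f : R -> 'rV[R]_n -> 'rV[R]_p -> 'rV[R]_n.
Variable Lr : R -> 'rV[R]_n -> 'rV[R]_p -> R.
Variable Lmx : R -> 'rV[R]_n -> R.
Variable Psi : 'rV[R]_n -> R.
Variable x0 : 'rV[R]_n.
Variable phi : R -> R.

Local Notation leb := (@completed_lebesgue_measure R).

Definition Delta_mx (s : R) (x : 'rV[R]_n) (v : 'rV[R]_p) : R :=
  partial_time t1 Lmx s x + \sum_(i < n) partial_space Lmx i s x * f s x v 0 i.

Definition avg (mu : Prob U) (g : 'rV[R]_p -> R) : R :=
  \int[prob_val mu]_(v in U) g v.

Definition state_solution (sigma : R -> Prob U) (x : R -> 'rV[R]_n) : Prop :=
  {within `[0, t1], continuous x} /\
  forall t : R, t \in `[0, t1] ->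
    x t = x0 + \row_i \int[leb]_(s in `[0, t])
                        avg (sigma s) (fun v => f s (x s) v 0 i).

(* The solution is unique on [0, t1]; cst x0 is only a syntactic default. *)
Definition state (sigma : R -> Prob U) : R -> 'rV[R]_n :=
  xget (cst x0) [set x | state_solution sigma x].

Definition smooth_max_solution (delta : R) (sigma : R -> Prob U) (y : R -> R) :
    Prop :=
  {within `[0, t1], continuous y} /\
  forall t : R, t \in `[0, t1] ->
    y t = Lmx 0 x0 + \int[leb]_(s in `[0, t])
      (psi phi delta (Lmx s (state sigma s) - y s) *
       avg (sigma s) (fun v => Num.max (Delta_mx s (state sigma s) v) 0)).

Definition running_max (sigma : R -> Prob U) (t : R) : R :=
  sup [set Lmx s (state sigma s) | s in `[0, t]].

Definition max_state (delta : R) (sigma : R -> Prob U) : R -> R :=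
  if delta == 0 then running_max sigma
  else xget (cst (Lmx 0 x0)) [set y | smooth_max_solution delta sigma y].

Definition Gamma (sigma : R -> Prob U) (delta : R) : R :=
  \int[leb]_(t in `[0, t1]) avg (sigma t) (fun v => Lr t (state sigma t) v)
  + Psi (state sigma t1) - max_state delta sigma t1.

(* Suprema of values are taken in \bar R, where they need no boundedness side
   condition. *)
Definition Gamma_star (delta : R) : \bar R :=
  ereal_sup [set (Gamma sigma delta)%:E | sigma in relaxed_controls t1 U].

Definition pure_Gamma_star (delta : R) : \bar R :=
  ereal_sup [set (Gamma (dirac_control u) delta)%:E | u in pure_controls t1 U].

Definition pure_state_solution (u : R -> U) (x : R -> 'rV[R]_n) : Prop :=
  {within `[0, t1], continuous x} /\
  forall t : R, t \in `[0, t1] ->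
    x t = x0 + \row_i \int[leb]_(s in `[0, t]) f s (x s) (set_val (u s)) 0 i.

Definition pure_state (u : R -> U) : R -> 'rV[R]_n :=
  xget (cst x0) [set x | pure_state_solution u x].

Definition J (u : R -> U) : R :=
  \int[leb]_(s in `[0, t1]) Lr s (pure_state u s) (set_val (u s))
  + Psi (pure_state u t1)
  - sup [set Lmx s (pure_state u s) | s in `[0, t1]].

End control_problem.

(* Main.v *)
Require Import Defs.
From HB Require Import structures.
From mathcomp Require Import all_boot all_order all_algebra.
From mathcomp Require Import all_classical all_reals all_analysis.
From mathcomp Require Import measurable_realfun ring lra.

Set Implicit Arguments.
Unset Strict Implicit.
Unset Printing Implicit Defensive.
Import Order.TTheory GRing.Theory Num.Theory.
Import numFieldNormedType.Exports.

Local Open Scope classical_set_scope.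
Local Open Scope ring_scope.

(** Along a relaxed control sigma with state x, let h t = Lmx t (x t).  The
    payoffs with parameters delta and 0 differ only in their last terms, the
    smoothed maximum y at time t1 and the true maximum of h.  The heart of the
    proof is the bound [max_state_bounds]

      sup h <= y t1 <= sup h + delta,

    which is uniform in sigma.  It gives, for every relaxed sigma,

      Gamma sigma 0 <= Gamma sigma (delta k) + delta k
                    <= Gamma (u k) (delta k) + delta k
                    <= Gamma (u k) 0 + delta k

    by optimality of u k for the smooth problem; so the value of the original
    problem lies between Gamma (u k) 0 and Gamma (u k) 0 + delta k.

    The two bounds on y.  Here h is a primitive of the average of Delta_mx, and y is
    driven by the cutoff psi times the average of the positive part of Delta_mx.
    Where h > y the cutoff is 1 and y grows at least as fast as h, so h cannot
    overtake y ([le_smooth_max]).  Where y > sup h + delta the cutoff is 0 and y is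
    constant, so y cannot pass this level ([smooth_max_le]).  Both arguments start
    from the last time at which the inequality held ([last_time]).

    Three facts support this argument.  The state and the smoothed maximum
    exist, by Picard iteration in a uniform norm with an exponential weight
    ([weighted_fixed_point], [state_solution_exists], [smooth_max_exists]).  The
    averages of continuous integrands along a relaxed control are measurable in
    time, by approximation with integrands frozen at rational times
    ([bounded_measurable_avg]), and pure controls are relaxed controls
    ([dirac_control_relaxed]).  Finally h is a primitive of the average of
    Delta_mx ([chain_rule]), although x is only the integral of a bounded
    measurable function: the increments of both sides over short intervals agree
    up to an error small relative to the length.

    The last claim, that the payoff of a pure control is J, holds because averages
    over Dirac masses are evaluations ([state_dirac], [Gamma_dirac]). *)

(** * Fixed points in a weighted uniform norm *)

(** Row vectors are complete and normed; declaring the join of the two structures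
    lets [weighted_fixed_point] apply to states. *)
HB.instance Definition _ (R : realType) (n : nat) := Complete.on 'rV[R]_n.

Lemma within_continuousP (R : realType) (T : topologicalType)
    (V : normedModType R) (A : set T) (f : T -> V) :
  {within A, continuous f} <->
  forall x, A x -> forall e, 0 < e ->
    \forall y \near x, A y -> `|f x - f y| < e.
Proof.
rewrite subspace_continuousP; split => cf x Ax.
  by move=> e e0; have /cvgrPdist_lt/(_ _ e0) := cf x Ax; rewrite near_withinE.
by apply/cvgrPdist_lt => e e0; rewrite near_withinE; exact: cf.
Qed.

Lemma within_compact_bounded (R : realType) (T : topologicalType)
    (V : normedModType R) (A : set T) (f : T -> V) :
  compact A -> {within A, continuous f} ->
  exists2 C, 0 <= C & forall x, A x -> `|f x| <= C.
Proof.
move=> cA cf; have [M [_ hM]] := compact_bounded (continuous_compact cf cA).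
exists (`|M| + 1) => [|x Ax]; first by rewrite addr_ge0.
by apply: hM; [rewrite ltr_pwDr// ler_norm|exists x].
Qed.

Section weighted_fixed_point.
Context {R : realType} {V : completeNormedModType R}.
Variables (A : set R) (w : R -> R) (W : R) (Phi : (R -> V) -> R -> V).

(** Picard iteration from 0 contracts by 1/2 in the norm sup |x t| / w t, so it
    converges uniformly on A.  For the integral operator of a differential
    equation with Lipschitz constant K, the weight exp (2 K t) gives this
    factor on the whole interval at once, whatever its length. *)
Lemma weighted_fixed_point :
  compact A ->
  (forall t, A t -> 1 <= w t <= W) ->
  (forall x, {within A, continuous x} -> {within A, continuous (Phi x)}) ->
  (forall x y C, 0 <= C ->
     {within A, continuous x} -> {within A, continuous y} ->
     (forall t, A t -> `|x t - y t| <= C * w t) ->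
     forall t, A t -> `|Phi x t - Phi y t| <= C / 2 * w t) ->
  exists2 x, {within A, continuous x} & forall t, A t -> x t = Phi x t.
Proof.
move=> cA wW cPhi hPhi.
pose X k := iter k Phi (cst 0).
have cX k : {within A, continuous (X k)}.
  elim: k => [|k ih]; last exact: cPhi.
  exact/continuous_subspaceT/cst_continuous.
have [D D0 hD] := within_compact_bounded cA (cX 1%N).
(* 1 <= w turns the uniform bound D on the first step into a weighted one *)
have step : forall k t, A t -> `|X k.+1 t - X k t| <= D / 2 ^+ k * w t.
  elim=> [|k ih] t At.
    rewrite expr0 invr1 mulr1 [X 0 t]/= subr0 (le_trans (hD _ At))//.
    by rewrite ler_peMr//; case/andP: (wW _ At).
  rewrite exprSr invfM mulrA.
  by apply: (hPhi (X k.+1) (X k)) => //; rewrite divr_ge0// exprn_ge0.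
have tail k m t : A t -> `|X (k + m)%N t - X k t| <= 2 * D / 2 ^+ k * w t.
  move=> At; have w0 : 0 <= w t by rewrite (le_trans ler01)//; case/andP: (wW _ At).
  suff : `|X (k + m)%N t - X k t| <= (2 * D / 2 ^+ k - 2 * D / 2 ^+ (k + m)) * w t.
    move=> /le_trans; apply; rewrite ler_wpM2r// lerBlDr lerDl.
    by rewrite divr_ge0// ?exprn_ge0// mulr_ge0.
  elim: m => [|m ih]; first by rewrite addn0 !subrr normr0 mul0r.
  rewrite addnS (le_trans (ler_distD (X (k + m)%N t) _ _))//.
  rewrite (le_trans (lerD (step _ _ At) ih))// -mulrDl ler_wpM2r// exprS.
  rewrite le_eqVlt; apply/orP; left; apply/eqP.
  by field; rewrite !expf_neq0.
have cvgX t : A t -> cvgn (X ^~ t).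
  move=> At.
  have w0 : 0 <= w t by rewrite (le_trans ler01)//; case/andP: (wW _ At).
  have : cvgn (series (telescope (X ^~ t))).
    apply: normed_cvg; apply: (@series_le_cvg _ _ (geometric (D * w t) 2^-1)).
    - by move=> k; exact: normr_ge0.
    - by move=> k; rewrite /geometric/= mulr_ge0 ?exprn_ge0 ?mulr_ge0.
    - move=> k; rewrite /telescope/= (le_trans (step _ _ At))//.
      by rewrite exprVn mulrAC.
    - by apply: is_cvg_geometric_series; rewrite ger0_norm ?invf_lt1// ltr1n.
  rewrite telescopeK => cX'; have -> : X ^~ t = (fun k => (X k t - X 0 t) + X 0 t).
    by apply/funext => k; rewrite subrK.
  by apply: is_cvgD => //; exact: is_cvg_cst.
pose x t := limn (X ^~ t).
have xX k t : A t -> `|x t - X k t| <= 2 * D / 2 ^+ k * w t.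
  move=> At; apply/ler_addgt0Pr => e e0.
  have /cvgrPdist_lt/(_ _ e0)[N _ hN] := cvgX _ At.
  rewrite (le_trans (ler_distD (X (k + N)%N t) _ _))// addrC lerD ?tail//.
  by apply/ltW/hN => /=; rewrite leq_addl.
have small e : 0 < e -> exists k, forall t, A t -> 2 * D / 2 ^+ k * w t < e.
  move=> e0.
  have [k hk] : exists k, 2 * D * `|W| / e < 2 ^+ k.
    have [k _ /(_ _ (leqnn _)) hk] := nbhs_infty_gtr (2 * D * `|W| / e).
    exists k; rewrite (lt_trans hk)// -natrX ltr_nat ltn_expl//.
  exists k => t At; have [w1 wW'] := andP (wW _ At).
  rewrite mulrAC ltr_pdivrMr ?exprn_gt0// [e * _]mulrC.
  move: hk; rewrite ltr_pdivrMr//; apply: le_lt_trans.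
  by rewrite ler_wpM2l ?mulr_ge0// (le_trans wW')// ler_norm.
have cx : {within A, continuous x}.
  apply/within_continuousP => t At e e0.
  have e3 : 0 < e / 3 by rewrite divr_gt0.
  have [k hk] := small _ e3.
  have /within_continuousP/(_ t At _ e3) := cX k.
  apply: filterS => s hs As.
  rewrite (le_lt_trans (ler_distD (X k t) _ _))//.
  have -> : e = e / 3 + (e / 3 + e / 3) by field.
  rewrite ltrD ?(le_lt_trans (xX _ _ At) (hk _ At))//.
  rewrite (le_lt_trans (ler_distD (X k s) _ _))// ltrD ?hs//.
  by rewrite distrC (le_lt_trans (xX _ _ As) (hk _ As)).
exists x => // t At; apply/eqP; rewrite -subr_eq0 -normr_le0.
apply/ler_addgt0Pr => e e0; rewrite add0r.
have [k hk] := small _ (divr_gt0 e0 (ltr0n _ 2)).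
rewrite (le_trans (ler_distD (X k.+1 t) _ _))// [leRHS]splitr lerD//.
  rewrite (le_trans (xX _ _ At))// (le_trans _ (ltW (hk _ At)))//.
  rewrite ler_wpM2r ?(le_trans ler01)//; first by case/andP: (wW _ At).
  by rewrite ler_wpM2l ?mulr_ge0// lef_pV2 ?posrE ?exprn_gt0// ler_eXn2l ?ltr1n.
rewrite distrC (le_trans (hPhi x (X k) (2 * D / 2 ^+ k) _ cx (cX k) _ t At))//.
- by rewrite divr_ge0 ?mulr_ge0 ?exprn_ge0.
- by move=> s; exact: xX.
- by have := hk t At; move: (2 * D / _) => q; lra.
Qed.
End weighted_fixed_point.

(** * Integrals over subintervals of a horizon *)

Local Notation leb := (@completed_lebesgue_measure _).

Section lebesgue_integrals.
Context {R : realType}.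
Implicit Types (t : R) (g h : R -> R).

Lemma borel_lebesgue (A : set R) :
  measurable (A : set (measurableTypeR R)) ->
  measurable (A : set (lebesgueType R)).
Proof. exact: sub_caratheodory. Qed.

Lemma measurable_itv_lebesgue (i : interval R) :
  measurable ([set` i] : set (lebesgueType R)).
Proof. by apply: borel_lebesgue; exact: measurable_itv. Qed.

Lemma leb_itv (a b : R) (x y : bool) : a <= b ->
  leb ([set` Interval (BSide x a) (BSide y b)] : set (lebesgueType R)) = (b - a)%:E.
Proof.
move=> ab; rewrite [LHS](_ : _ = lebesgue_measure
  [set` Interval (BSide x a) (BSide y b)])// lebesgue_measure_itv/= lte_fin.
by case: ltgtP ab => // ->; rewrite subrr.
Qed.

Lemma measurable_borel_lebesgue (D : set R) g :
  measurable (D : set (measurableTypeR R)) ->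
  measurable_fun (D : set (measurableTypeR R)) g ->
  measurable_fun (D : set (lebesgueType R)) g.
Proof. by move=> mD mg _ Y mY; apply: borel_lebesgue; exact: mg. Qed.

(** The integrands of the control problem: this class contains the continuous
    functions, is closed under the algebraic operations and is integrable on
    every subinterval of the horizon [0, T]. *)
Definition bounded_measurable (T : R) (g : R -> R) :=
  measurable_fun (`[0, T] : set (lebesgueType R)) g /\
  exists2 C, 0 <= C & forall s, s \in `[0, T] -> `|g s| <= C.

Lemma bounded_measurable_continuous T g :
  {within `[0, T], continuous g} -> bounded_measurable T g.
Proof.
move=> cg; split.
  apply: measurable_borel_lebesgue; first exact: measurable_itv.
  by apply: subspace_continuous_measurable_fun => //; exact: measurable_itv.
exact: (within_compact_bounded (@segment_compact _ 0 T) cg).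
Qed.

Lemma bounded_measurable_cst T c : bounded_measurable T (cst c).
Proof. by split => //; exists `|c|. Qed.

Lemma bounded_measurableD T g h :
  bounded_measurable T g -> bounded_measurable T h ->
  bounded_measurable T (fun s => g s + h s).
Proof.
move=> [mg [C C0 hC]] [mh [D D0 hD]]; split; first exact: measurable_funD.
exists (C + D); first exact: addr_ge0.
by move=> s sT; rewrite (le_trans (ler_normD _ _))// lerD ?hC ?hD.
Qed.

Lemma bounded_measurableM T g h :
  bounded_measurable T g -> bounded_measurable T h ->
  bounded_measurable T (fun s => g s * h s).
Proof.
move=> [mg [C C0 hC]] [mh [D D0 hD]]; split; first exact: measurable_funM.
exists (C * D); first exact: mulr_ge0.
by move=> s sT; rewrite normrM ler_pM// ?hC ?hD.
Qed.

Lemma bounded_measurableB T g h :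
  bounded_measurable T g -> bounded_measurable T h ->
  bounded_measurable T (fun s => g s - h s).
Proof.
move=> mg mh; under eq_fun do rewrite -mulN1r.
apply: (bounded_measurableD mg); apply: (bounded_measurableM _ mh).
exact: bounded_measurable_cst.
Qed.

Lemma bounded_measurable_sum T (I : finType) (g : I -> R -> R) :
  (forall i, bounded_measurable T (g i)) ->
  bounded_measurable T (fun s => \sum_i g i s).
Proof.
move=> mg; elim: (index_enum I) => [|i r ih].
  by under eq_fun do rewrite big_nil; exact: bounded_measurable_cst.
by under eq_fun do rewrite big_cons; exact: bounded_measurableD.
Qed.

Lemma bounded_measurable_eq T g h :
  (forall s, s \in `[0, T] -> g s = h s) ->
  bounded_measurable T g -> bounded_measurable T h.
Proof.
move=> gh [mg [C C0 hC]]; split.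
  by apply: eq_measurable_fun mg => s /set_mem/= sT; exact: gh.
by exists C => // s sT; rewrite -gh// hC.
Qed.

Lemma sub_horizon T s t : 0 <= s -> t <= T -> [set` `]s, t]] `<=` [set` `[0, T]].
Proof.
move=> s0 tT r /=; rewrite !in_itv/= => /andP[sr rt].
by rewrite (le_trans s0 (ltW sr)) (le_trans rt tT).
Qed.

Lemma bounded_measurable_integrable T g (D : set (lebesgueType R)) :
  bounded_measurable T g -> measurable D -> D `<=` [set` `[0, T]] ->
  leb.-integrable D (EFin \o g).
Proof.
move=> [mg [C C0 hC]] mD DT.
have mT : measurable ([set` `[0, T]] : set (lebesgueType R)).
  exact: measurable_itv_lebesgue.
apply: measurable_bounded_integrable => //.
- apply: (@le_lt_trans _ _ (leb ([set` `[0, T]] : set (lebesgueType R)))).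
    by apply: le_measure; rewrite ?inE.
  have [T0|T0] := leP 0 T; first by rewrite leb_itv// ltry.
  by rewrite set_itv_ge ?measure0// -leNgt bnd_simp.
- exact: measurable_funS mg.
- exists C; split; first exact: num_real.
  by move=> M CM s Ds /=; rewrite (le_trans _ (ltW CM))// hC//; exact: DT.
Qed.

Let integrable_oc T g s t : bounded_measurable T g -> 0 <= s -> t <= T ->
  leb.-integrable (`]s, t] : set (lebesgueType R)) (EFin \o g).
Proof.
move=> mg s0 tT; apply: bounded_measurable_integrable mg _ _.
  exact: measurable_itv_lebesgue.
exact: sub_horizon.
Qed.

Lemma Rintegral_split T g s t : bounded_measurable T g ->
  0 <= s -> s <= t -> t <= T ->
  \int[leb]_(r in `[0, t]) g r =
  \int[leb]_(r in `[0, s]) g r + \int[leb]_(r in `]s, t]) g r.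
Proof.
move=> mg s0 st tT.
have -> : `[0, t]%classic = `[0, s]%classic `|` `]s, t]%classic :> set R.
  by rewrite (@itv_bndbnd_setU _ _ _ (BRight s))// bnd_simp.
rewrite Rintegral_setU//; try exact: measurable_itv_lebesgue.
- apply: bounded_measurable_integrable mg _ _.
    by apply: measurableU; exact: measurable_itv_lebesgue.
  move=> r /= []; rewrite !in_itv/=; last by case/andP=> /ltW; lra.
  by case/andP; lra.
- apply/disj_setPS => r [/=]; rewrite !in_itv/= => /andP[_ rs] /andP[].
  by rewrite ltNge rs.
Qed.

Lemma le_Rintegral_oc T g h s t :
  bounded_measurable T g -> bounded_measurable T h -> 0 <= s -> t <= T ->
  (forall r, r \in `]s, t] -> g r <= h r) ->
  \int[leb]_(r in `]s, t]) g r <= \int[leb]_(r in `]s, t]) h r.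
Proof.
move=> mg mh s0 tT gh; apply: le_Rintegral.
- exact: measurable_itv_lebesgue.
- exact: integrable_oc mg _ _.
- exact: integrable_oc mh _ _.
- by move=> r; exact: gh.
Qed.

Lemma Rintegral_oc_cst s t c : s <= t ->
  \int[leb]_(r in (`]s, t] : set (lebesgueType R))) c = c * (t - s).
Proof.
move=> st; have mst := measurable_itv_lebesgue `]s, t].
by rewrite (Rintegral_cst leb mst)//= [X in fine X](leb_itv false false st).
Qed.

Lemma normr_Rintegral_oc_le T g s t C :
  bounded_measurable T g -> 0 <= s -> s <= t -> t <= T ->
  (forall r, r \in `]s, t] -> `|g r| <= C) ->
  `|\int[leb]_(r in `]s, t]) g r| <= C * (t - s).
Proof.
move=> mg s0 st tT gC; have mc c := bounded_measurable_cst T c.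
rewrite -Rintegral_oc_cst// ler_norml; apply/andP; split.
  rewrite Rintegral_oc_cst// -mulNr -Rintegral_oc_cst//.
  apply: (le_Rintegral_oc (mc _) mg s0 tT) => r /gC.
  by rewrite ler_norml => /andP[].
apply: (le_Rintegral_oc mg (mc _) s0 tT) => r /gC.
by rewrite ler_norml => /andP[].
Qed.

Lemma Rintegral_ocB T g h s t :
  bounded_measurable T g -> bounded_measurable T h -> 0 <= s -> t <= T ->
  \int[leb]_(r in `]s, t]) (g r - h r) =
  \int[leb]_(r in `]s, t]) g r - \int[leb]_(r in `]s, t]) h r.
Proof.
move=> mg mh s0 tT; rewrite RintegralB//.
- exact: measurable_itv_lebesgue.
- exact: integrable_oc mg _ _.
- exact: integrable_oc mh _ _.
Qed.

Lemma Rintegral_ocD T g h s t :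
  bounded_measurable T g -> bounded_measurable T h -> 0 <= s -> t <= T ->
  \int[leb]_(r in `]s, t]) (g r + h r) =
  \int[leb]_(r in `]s, t]) g r + \int[leb]_(r in `]s, t]) h r.
Proof.
move=> mg mh s0 tT; rewrite RintegralD//.
- exact: measurable_itv_lebesgue.
- exact: integrable_oc mg _ _.
- exact: integrable_oc mh _ _.
Qed.

Lemma Rintegral_ocZ T g s t c :
  bounded_measurable T g -> 0 <= s -> t <= T ->
  \int[leb]_(r in `]s, t]) (c * g r) = c * \int[leb]_(r in `]s, t]) g r.
Proof.
move=> mg s0 tT; rewrite RintegralZl//.
- exact: measurable_itv_lebesgue.
- exact: integrable_oc mg _ _.
Qed.

Lemma Rintegral_oc_sum T (I : finType) (g : I -> R -> R) s t :
  (forall i, bounded_measurable T (g i)) -> 0 <= s -> s <= t -> t <= T ->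
  \int[leb]_(r in `]s, t]) (\sum_i g i r) =
  \sum_i \int[leb]_(r in `]s, t]) g i r.
Proof.
move=> mg s0 st tT; elim: (index_enum I) => [|i r ih].
  under eq_Rintegral do rewrite big_nil.
  by rewrite Rintegral_oc_cst// big_nil mul0r.
under eq_Rintegral do rewrite big_cons.
rewrite big_cons -ih; apply: (Rintegral_ocD (mg i) _ s0 tT).
elim: r {ih} => [|j r ih].
  by under eq_fun do rewrite big_nil; exact: bounded_measurable_cst.
by under eq_fun do rewrite big_cons; exact: bounded_measurableD.
Qed.


(** The equations of the problem integrate over [0, t] and their increments over
    ]s, t]; the two conventions agree because a point has measure zero. *)
Lemma Rintegral_oc0 T g t : bounded_measurable T g -> 0 <= t <= T ->
  \int[leb]_(r in `[0, t]) g r = \int[leb]_(r in `]0, t]) g r.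
Proof.
move=> mg /andP[t0 tT]; have T0 := le_trans t0 tT.
rewrite (Rintegral_split mg _ t0 tT)// [X in X + _](_ : _ = 0) ?add0r//.
have [_ [C C0 hC]] := mg.
have m00 := measurable_itv_lebesgue `[0, 0].
have sub00 : [set` `[0, 0]] `<=` [set` `[0, T]].
  by move=> r /=; rewrite !in_itv/= => /andP[]; lra.
have ig h : bounded_measurable T h ->
    leb.-integrable ([set` `[0, 0]] : set (lebesgueType R)) (EFin \o h).
  by move=> mh; exact: bounded_measurable_integrable mh m00 sub00.
apply/eqP; rewrite -normr_le0 (le_trans (le_normr_Rintegral m00 (ig _ mg)))//.
have := @Rintegral_cst _ _ _ (@completed_lebesgue_measure R) _ m00 C.
rewrite [X in _ * fine X](leb_itv true false (lexx 0)) subrr mulr0 => int0.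
rewrite -[leRHS]int0.
apply: (le_Rintegral m00) => [||r /sub00].
- exact/integrable_norm/ig.
- exact/(ig (cst C))/bounded_measurable_cst.
- exact: hC.
Qed.

(** A bound C on |g| makes the primitive C-Lipschitz. *)
Lemma continuous_primitive T g c : bounded_measurable T g ->
  {within `[0, T], continuous (fun t => c + \int[leb]_(r in `[0, t]) g r)}.
Proof.
move=> mg; have [_ [C C0 hC]] := mg.
apply/within_continuousP => t; rewrite /= in_itv/= => /andP[t0 tT] e e0.
have C1 : 0 < C + 1 by rewrite ltr_wpDl.
near=> s; rewrite /= in_itv/= => /andP[s0 sT].
have lip a b : 0 <= a -> a <= b -> b <= T ->
    `|(c + \int[leb]_(r in `[0, b]) g r) -
      (c + \int[leb]_(r in `[0, a]) g r)| <= C * (b - a).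
  move=> a0 ab bT; rewrite (Rintegral_split mg a0 ab bT).
  rewrite opprD addrACA subrr add0r addrAC subrr add0r.
  apply: (normr_Rintegral_oc_le mg) => // r rab; apply: hC.
  exact: (sub_horizon a0 bT).
have : `|t - s| < e / (C + 1).
  by near: s; apply: cvgr_dist_lt => //; rewrite divr_gt0.
rewrite ltr_pdivlMr// => ts.
have [st|/ltW st] := leP t s.
- rewrite distrC (le_lt_trans (lip _ _ _ _ _))// (le_lt_trans _ ts)//.
  rewrite distrC ger0_norm ?subr_ge0// mulrC ler_wpM2l ?subr_ge0//.
  by rewrite lerDl.
- rewrite (le_lt_trans (lip _ _ _ _ _))// (le_lt_trans _ ts)//.
  rewrite ger0_norm ?subr_ge0// mulrC ler_wpM2l ?subr_ge0//.
  by rewrite lerDl.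
Unshelve. all: by end_near. Qed.

End lebesgue_integrals.

(** * Primitives and the Volterra estimate *)

Section zero_derivative.
Context {R : realType}.

(** The hypothesis bounds increments between any two points near c, not only
    from c: this is the form that mean value estimates provide, and it covers
    the end points of [0, T] as well.  It gives continuity and a zero
    derivative inside, so the mean value theorem applies. *)
Lemma locally_flat_constant (T : R) (G : R -> R) :
  (forall c, c \in `[0, T] -> forall e, 0 < e ->
     exists2 eta, 0 < eta & forall s t, 0 <= s -> s <= t -> t <= T ->
       `|s - c| < eta -> `|t - c| < eta -> `|G t - G s| <= e * (t - s)) ->
  forall s t : R, 0 <= s -> s <= t -> t <= T -> G t = G s.
Proof.
move=> flat s t s0; rewrite le_eqVlt => /predU1P[->//|st] tT.
have sub r : r \in `[s, t] -> r \in `[0, T].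
  by rewrite !in_itv/= => /andP[? ?]; apply/andP; split; lra.
have dG r : r \in `]s, t[ -> is_derive r 1 G 0.
  move=> rst.
  suff cvgG : (fun h => h^-1 *: (G (h *: 1 + r) - G r)) @ 0^' --> (0 : R).
    by apply: DeriveDef; [apply/cvg_ex; exists 0|exact: cvg_lim].
  apply/cvgrPdist_le => e e0.
  have [|eta eta0 heta] := flat r _ _ e0.
    by apply: sub; exact: subset_itv_oo_cc.
  move: rst; rewrite in_itv/= => /andP[sr rt].
  near=> h; rewrite sub0r normrN normrZ normfV [h *: 1]mulr1.
  have h0 : h != 0 by near: h; exact: nbhs_dnbhs_neq.
  have hsmall : `|h| < Num.min eta (Num.min (r - s) (t - r)).
    near: h; apply: dnbhs0_lt.
    by rewrite !lt_min eta0/= !subr_gt0 sr rt.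
  move: hsmall; rewrite !lt_min => /and3P[heta' hs ht].
  rewrite ler_pdivrMl ?normr_gt0// mulrC.
  have [hge|/ltW hle] := leP 0 h.
    rewrite ger0_norm// in ht heta' *.
    have -> : e * h = e * (h + r - r) by rewrite addrK.
    apply: heta; rewrite ?subrr ?normr0 ?addrK ?ger0_norm//; lra.
  rewrite ler0_norm// in hs heta' *.
  have -> : e * - h = e * (r - (h + r)) by rewrite opprD addrCA subrr addr0.
  rewrite distrC.
  apply: heta; rewrite ?subrr ?normr0 ?addrK ?ler0_norm//; lra.
have cG : {within `[s, t], continuous G}.
  apply/within_continuousP => c cst e e0.
  have [eta eta0 heta] := flat c (sub _ cst) 1 ltr01.
  near=> r => rst.
  have rc : `|r - c| < Num.min eta e.
    rewrite distrC; near: r; apply: cvgr_dist_lt => //.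
    by rewrite lt_min eta0.
  move: rc; rewrite lt_min => /andP[rc re].
  have /andP[c0 cT] : 0 <= c <= T by have := sub _ cst; rewrite in_itv.
  have /andP[r0 rT] : 0 <= r <= T by have := sub _ rst; rewrite in_itv.
  have [cr|/ltW rc'] := leP c r.
    rewrite distrC (le_lt_trans (heta _ _ c0 cr rT _ _))// ?subrr ?normr0//.
    by rewrite mul1r (le_lt_trans (ler_norm _)).
  rewrite (le_lt_trans (heta _ _ r0 rc' cT _ _))// ?subrr ?normr0//.
  by rewrite mul1r (le_lt_trans (ler_norm _))// distrC.
have [c _] := MVT st dG cG.
by rewrite mul0r => /eqP; rewrite subr_eq0 => /eqP.
Unshelve. all: by end_near. Qed.

(** The difference between G and the primitive of g has locally flat increments:
    on a short interval, both G and the primitive grow at a rate close to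
    g c. *)
Lemma Rintegral_oc_derive (T : R) (G g : R -> R) (s t : R) :
  (forall x : R, is_derive x 1 G (g x)) -> continuous g ->
  0 <= s -> s <= t -> t <= T ->
  \int[leb]_(r in `]s, t]) g r = G t - G s.
Proof.
move=> dG cg s0 st tT.
have mg : bounded_measurable T g.
  exact/bounded_measurable_continuous/continuous_subspaceT.
suff H : G t - \int[leb]_(r in `[0, t]) g r = G s - \int[leb]_(r in `[0, s]) g r.
  by move: H (Rintegral_split mg s0 st tT); clear; lra.
apply: (@locally_flat_constant T (fun t => G t - \int[leb]_(r in `[0, t]) g r)) => //.
move=> c _ e e0.
have e2 : 0 < e / 2 by rewrite divr_gt0.
have /cvgrPdist_lt/(_ _ e2) := cg c.
case=> eta /= eta0 heta; exists eta => // a b a0 ab bT ac bc.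
rewrite (Rintegral_split mg a0 ab bT).
have cG : {within `[a, b], continuous G}.
  apply: derivable_within_continuous => x _.
  exact: @ex_derive.
have [d dab dE] := MVT_segment ab (fun x _ => dG x) cG.
have near_c r : r \in `[a, b] -> `|g c - g r| < e / 2.
  rewrite in_itv/= => /andP[ar rb]; apply: heta => /=.
  move: ac bc; rewrite !ltr_norml => /andP[? ?] /andP[? ?].
  by apply/andP; split; lra.
have mc := bounded_measurable_cst T (g d).
have -> : G b - (\int[leb]_(r in `[0, a]) g r + \int[leb]_(r in `]a, b]) g r) -
    (G a - \int[leb]_(r in `[0, a]) g r) =
    - \int[leb]_(r in `]a, b]) (g r - g d).
  rewrite (Rintegral_ocB mg mc a0 bT) Rintegral_oc_cst// -dE.
  by clear; lra.
rewrite normrN.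
apply: (normr_Rintegral_oc_le (bounded_measurableB mg mc) a0 ab bT).
move=> r /subset_itv_oc_cc/near_c gr; have gd := near_c _ dab.
rewrite (le_trans (ler_distD (g c) _ _))// [leRHS]splitr lerD// ?(ltW gd)//.
by rewrite distrC ltW.
Qed.

(** The primitive of K C exp (2 K s) is C / 2 exp (2 K s): integrating a Lipschitz
    estimate with constant K halves the weighted distance, as
    [weighted_fixed_point] demands. *)
Lemma volterra_contraction (T K C : R) (g h : R -> R) (t : R) : 0 < K ->
  bounded_measurable T g -> bounded_measurable T h ->
  (forall s, s \in `[0, T] -> `|g s - h s| <= K * (C * expR (2 * K * s))) ->
  0 <= C -> t \in `[0, T] ->
  `|\int[leb]_(r in `[0, t]) g r - \int[leb]_(r in `[0, t]) h r|
    <= C / 2 * expR (2 * K * t).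
Proof.
move=> K0 mg mh gh C0; rewrite in_itv/= => tT; have [t0 tT'] := andP tT.
rewrite !(Rintegral_oc0 _ tT)// -(Rintegral_ocB mg mh (lexx 0) tT').
pose G s := C / 2 * expR (2 * K * s).
pose dG s := K * (C * expR (2 * K * s)).
have cdG : continuous dG.
  move=> s; apply: cvgMr; apply: cvgMr.
  apply: (@continuous_comp _ _ _ (fun s => 2 * K * s) expR).
    by apply: cvgMr; exact: cvg_id.
  exact: continuous_expR.
have GdG (s : R) : is_derive s 1 G (dG s).
  rewrite /G; apply: is_derive_eq.
  rewrite /dG /GRing.scale/=; clear; lra.
have mdG : bounded_measurable T dG.
  exact/bounded_measurable_continuous/continuous_subspaceT.
have mNdG : bounded_measurable T (fun s => - 1 * dG s).
  exact: bounded_measurableM (bounded_measurable_cst _ _) mdG.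
have mgh := bounded_measurableB mg mh.
have ghs s : s \in `]0, t] -> `|g s - h s| <= dG s.
  by move=> st; apply: gh; exact: (sub_horizon (lexx 0) tT').
have IdG : \int[leb]_(r in `]0, t]) dG r = G t - G 0.
  exact: (Rintegral_oc_derive GdG cdG _ _ tT').
have G0 : 0 <= G 0 by rewrite mulr_ge0 ?divr_ge0 ?expR_ge0.
rewrite -/(G t) (@le_trans _ _ (\int[leb]_(r in `]0, t]) dG r))//; last first.
  by rewrite IdG lerBlDr lerDl.
rewrite ler_norml; apply/andP; split.
  rewrite -mulN1r -(Rintegral_ocZ _ mdG (lexx 0) tT').
  apply: (le_Rintegral_oc mNdG mgh (lexx 0) tT') => s /ghs.
  by rewrite mulN1r ler_norml => /andP[].
apply: (le_Rintegral_oc mgh mdG (lexx 0) tT') => s /ghs.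
by rewrite ler_norml => /andP[].
Qed.

End zero_derivative.

(** * Averages over a probability measure on a compact set *)

Section relaxed_averages.
Context {R : realType} {p : nat}.
Implicit Types (U : set 'rV[R]_p) (g h : 'rV[R]_p -> R).

Lemma compact_measurable_rV U : compact U -> measurable (U : set (borelType R p)).
Proof.
move=> cU; rewrite -[U]setCK; apply: measurableC; apply: sub_sigma_algebra.
by apply: closed_openC; apply: compact_closed => //; exact: norm_hausdorff.
Qed.

Lemma prob_mass U (mu : Prob U) : prob_val mu U = 1%E.
Proof. by have := set_valP mu. Qed.

Lemma relatively_open_measurable U (O : set 'rV[R]_p) : compact U ->
  open (O : set (subspace U)) -> measurable (U `&` O : set (borelType R p)).
Proof.
move=> cU /open_subspaceP[V oV VU]; rewrite setIC -VU; apply: measurableI.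
  exact: sub_sigma_algebra.
exact: compact_measurable_rV.
Qed.

Lemma measurable_continuous_on U g : compact U -> {within U, continuous g} ->
  measurable_fun (U : set (borelType R p)) g.
Proof.
move=> cU /continuousP cg.
apply: (measurability _ (RGenOpens.measurableE R)).
move=> _ [_ [a [b ->] <-]]; apply: relatively_open_measurable => //.
exact/cg/interval_open.
Qed.

Lemma integrable_continuous_on U (mu : Prob U) g :
  compact U -> {within U, continuous g} ->
  (prob_val mu).-integrable U (EFin \o g).
Proof.
move=> cU cg; have mU := compact_measurable_rV cU.
apply: measurable_bounded_integrable => //.
- by apply: (le_lt_trans (probability_le1 _ mU)); rewrite ltry.
- exact: measurable_continuous_on.
- have [C C0 hC] := within_compact_bounded cU cg.
  exists C; split; first exact: num_real.
  by move=> M CM v Uv /=; rewrite (le_trans _ (ltW CM))// hC.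
Qed.

Lemma avg_cst U (mu : Prob U) c : compact U -> avg mu (fun=> c) = c.
Proof.
move=> cU; have mU := compact_measurable_rV cU.
by rewrite /avg (Rintegral_cst _ mU) [X in fine X](prob_mass mu) mulr1.
Qed.

Lemma le_avg U (mu : Prob U) g h : compact U ->
  {within U, continuous g} -> {within U, continuous h} ->
  (forall v, U v -> g v <= h v) -> avg mu g <= avg mu h.
Proof.
move=> cU cg ch gh; apply: le_Rintegral => //.
- exact: compact_measurable_rV.
- exact: integrable_continuous_on.
- exact: integrable_continuous_on.
Qed.

Lemma avg_ge0 U (mu : Prob U) g : (forall v, U v -> 0 <= g v) -> 0 <= avg mu g.
Proof. by move=> g0; exact: Rintegral_ge0. Qed.

Lemma avgD U (mu : Prob U) g h : compact U ->
  {within U, continuous g} -> {within U, continuous h} ->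
  avg mu (fun v => g v + h v) = avg mu g + avg mu h.
Proof.
move=> cU cg ch; rewrite /avg RintegralD//.
- exact: compact_measurable_rV.
- exact: integrable_continuous_on.
- exact: integrable_continuous_on.
Qed.

Lemma avgZ U (mu : Prob U) c g : compact U -> {within U, continuous g} ->
  avg mu (fun v => c * g v) = c * avg mu g.
Proof.
move=> cU cg; rewrite /avg RintegralZl//.
- exact: compact_measurable_rV.
- exact: integrable_continuous_on.
Qed.

Lemma avg_sum U (mu : Prob U) (I : finType) (g : I -> 'rV[R]_p -> R) :
  compact U -> (forall i, {within U, continuous (g i)}) ->
  avg mu (fun v => \sum_i g i v) = \sum_i avg mu (g i).
Proof.
move=> cU cg.
suff [] : {within U, continuous (fun v => \sum_i g i v)} /\
    avg mu (fun v => \sum_i g i v) = \sum_i avg mu (g i) by [].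
elim: (index_enum I) => [|i r [cr ih]].
  under eq_fun do rewrite big_nil.
  by rewrite big_nil avg_cst//; split => //; exact: cst_continuous.
under eq_fun do rewrite big_cons.
rewrite big_cons avgD// ih; split => //.
by move=> x; apply: cvgD; [exact: cg|exact: cr].
Qed.

(** The mass of mu is 1, so averaging cannot enlarge a uniform distance. *)
Lemma normr_avgB_le U (mu : Prob U) g h C : compact U ->
  {within U, continuous g} -> {within U, continuous h} ->
  (forall v, U v -> `|g v - h v| <= C) -> `|avg mu g - avg mu h| <= C.
Proof.
move=> cU cg ch ghC.
have cC (c : R) : {within U, continuous (fun _ : 'rV[R]_p => c)}.
  exact: cst_continuous.
have cghC k1 k2 : {within U, continuous k1} -> {within U, continuous k2} ->
    (forall v, U v -> k1 v <= k2 v + C) -> avg mu k1 <= avg mu k2 + C.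
  move=> ck1 ck2 kC; rewrite -[X in _ + X](avg_cst mu _ cU) -avgD//.
  by apply: le_avg => // x; apply: cvgD; [exact: ck2|exact: cC].
rewrite ler_norml; apply/andP; split.
  rewrite lerNl opprB lerBlDl; apply: cghC => // v /ghC.
  by rewrite ler_norml => /andP[]; lra.
rewrite lerBlDl; apply: cghC => // v /ghC.
by rewrite ler_norml => /andP[]; lra.
Qed.

Lemma avg_dirac U (v : U) g : compact U -> {within U, continuous g} ->
  avg (prob_dirac v) g = g (set_val v).
Proof.
move=> cU cg; have mU := compact_measurable_rV cU.
have mg : measurable_fun (U : set (borelType R p)) (EFin \o g).
  by apply/measurable_EFinP; exact: measurable_continuous_on.
have := integral_dirac (set_val v : borelType R p) mU mg.
by rewrite diracE mem_set ?mul1e; [rewrite /avg /Rintegral => ->|exact: set_valP].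
Qed.

End relaxed_averages.

(** * Measurability along a relaxed control *)

Section measurability_along_controls.
Context {R : realType} {p : nat}.
Implicit Types (U : set 'rV[R]_p) (g : 'rV[R]_p -> R).

Lemma continuous_bounded_on U g : compact U -> {within U, continuous g} ->
  bounded_continuous_on U g.
Proof.
move=> cU cg; split=> //; have [C C0 hC] := within_compact_bounded cU cg.
exists C; split; first exact: num_real.
by move=> M CM v Uv /=; rewrite (le_trans _ (ltW CM))// hC.
Qed.

Lemma weak_open_avg_gt U g a : compact U -> {within U, continuous g} ->
  weak_open [set mu : Prob U | a < avg mu g].
Proof.
move=> cU cg.
pose g' : set_type (bounded_continuous_on U) :=
  SigSub (mem_set (continuous_bounded_on cU cg)).
exists (proj g' @^-1` `]a, +oo[%classic).
  apply: open_comp; last exact: interval_open.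
  by move=> x _; exact: proj_continuous.
apply/funext => mu; apply/propext => /=.
by rewrite /proj in_itv/= andbT /weak_ev/=.
Qed.

Lemma measurable_avg_gt (t1 : R) U (sigma : R -> Prob U) g a :
  compact U -> relaxed_controls t1 U sigma -> {within U, continuous g} ->
  measurable (`[0, t1] `&` [set s | a < avg (sigma s) g] : set (lebesgueType R)).
Proof.
move=> cU msigma cg; apply: (msigma [set mu | a < avg mu g]).
by apply: sub_sigma_algebra; exact: weak_open_avg_gt.
Qed.

(** A single modulus eta for all times and controls lets a time be replaced by a
    nearby one under the average, uniformly; it comes from compactness of
    [0, t1] x U. *)
Lemma uniform_modulus (t1 : R) U (G : R -> 'rV[R]_p -> R) : compact U ->
  {within `[0, t1] `*` U, continuous (fun z => G z.1 z.2)} ->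
  forall e, 0 < e -> exists2 eta, 0 < eta & forall s s' v,
    s \in `[0, t1] -> s' \in `[0, t1] -> U v -> `|s - s'| < eta ->
    `|G s v - G s' v| <= e.
Proof.
move=> cU cG e e0.
have cTU : compact (`[0, t1]%classic `*` U).
  exact: compact_setX (@segment_compact _ _ _) cU.
(* the estimate at z with modulus eta, to be made uniform in z by compactness *)
pose P (eta : R) (z : R * 'rV[R]_p) := forall s', s' \in `[0, t1] ->
  `[0, t1]%classic z.1 -> U z.2 ->
  `|z.1 - s'| < eta -> `|G z.1 z.2 - G s' z.2| <= e.
have : near_covering (`[0, t1]%classic `*` U) by exact/compact_near_coveringP.
move=> /(_ _ (0^'+ : set_system R) P _) [].
  move=> [s v] [/= sT Uv].
  have /within_continuousP/(_ (s, v)) := cG.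
  move=> /(_ (conj sT Uv) (e / 2)); rewrite divr_gt0// => /(_ isT)[[A B]/= [nA nB] AB].
  have [r /= r0 rA] := nA.
  exists ((ball s (r / 2) `&` A) `*` B, [set eta | 0 < eta < r / 2]).
    split => /=.
      exists (ball s (r / 2) `&` A, B) => //=; split => //; apply: filterI => //.
      by apply: nbhsx_ballx; rewrite divr_gt0.
    near=> eta; rewrite /=; apply/andP; split; near: eta.
      exact: nbhs_right_gt.
    by apply: nbhs_right_lt; rewrite divr_gt0.
  move=> [[s1 v1] eta] [/= [[bs1 As1] Bv1] /andP[eta0 etar]].
  move=> s' s'T s1T Uv1 s1s'.
  have s'A : A s'.
    apply: rA => /=; rewrite (le_lt_trans (ler_distD s1 _ _))// [ltRHS]splitr.
    by rewrite ltrD// (lt_trans s1s').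
  rewrite (le_trans (ler_distD (G s v) _ _))// [leRHS]splitr lerD//.
    rewrite distrC ltW//; exact: (AB (s1, v1) (conj As1 Bv1) (conj s1T Uv1)).
  by rewrite ltW//; exact: (AB (s', v1) (conj s'A Bv1) (conj s'T Uv1)).
move=> eta /= eta0 /(_ (eta / 2)) H.
exists (eta / 2); first by rewrite divr_gt0.
move=> s s' v sT s'T Uv ss'; apply: (H _ _ (s, v)) => //.
- by rewrite /= sub0r normrN gtr0_norm ?divr_gt0// ltr_pdivrMr// ltr_pMr// ltr1n.
- by rewrite divr_gt0.
Unshelve. all: by end_near. Qed.

Lemma slice_continuous (t1 : R) U (G : R -> 'rV[R]_p -> R) s :
  {within `[0, t1] `*` U, continuous (fun z => G z.1 z.2)} ->
  s \in `[0, t1] -> {within U, continuous (G s)}.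
Proof.
move=> cG sT; apply/within_continuousP => v Uv e e0.
have /within_continuousP/(_ (s, v) (conj sT Uv) _ e0)[[A B]/= [nA nB] AB] := cG.
apply: filterS nB => w Bw Uw.
by apply: (AB (s, w)) => //=; split => //; exact: nbhs_singleton nA.
Qed.

(** For an integrand frozen at a time q, measurability in s of the average is what
    measurability for the weak topology provides.  The moving integrand is
    reduced to countably many frozen ones: avg (sigma s) (G s) exceeds a iff for
    some m and some rational time q within the modulus eta m of s, the average
    of G q exceeds a + 1 / (m + 1). *)
Lemma bounded_measurable_avg (t1 : R) U (sigma : R -> Prob U)
    (G : R -> 'rV[R]_p -> R) :
  0 < t1 -> compact U -> relaxed_controls t1 U sigma ->
  {within `[0, t1] `*` U, continuous (fun z => G z.1 z.2)} ->
  bounded_measurable t1 (fun s => avg (sigma s) (G s)).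
Proof.
move=> t10 cU msigma cG; split; last first.
  have cTU : compact (`[0, t1]%classic `*` U).
    exact: compact_setX (@segment_compact _ _ _) cU.
  have [C C0 hC] := within_compact_bounded cTU cG.
  exists C => // s sT; rewrite -[avg _ _]subr0 -(avg_cst (sigma s) 0 cU).
  apply: normr_avgB_le => //; first exact: slice_continuous sT.
    exact: cst_continuous.
  by move=> v Uv; rewrite subr0 (hC (s, v)).
apply: (measurability _ (RGenOInfty.measurableE R)).
move=> _ [_ [a ->] <-].
have /choice[eta heta] : forall m : nat, exists eta : R, 0 < eta /\
    forall s s' v, s \in `[0, t1] -> s' \in `[0, t1] -> U v ->
      `|s - s'| < eta -> `|G s v - G s' v| <= m.+1%:R^-1.
  move=> m; have m0 : 0 < m.+1%:R^-1 :> R by rewrite invr_gt0.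
  by have [eta eta0 H] := uniform_modulus cU cG m0; exists eta.
(* rational times truncated to [0, t1], where G is known to be continuous *)
pose c (q : rat) : R := Num.max 0 (Num.min t1 (ratr q)).
have cT q : c q \in `[0, t1].
  by rewrite in_itv/= le_max lexx/= ge_max (ltW t10) ge_min lexx.
have close m q s : s \in `[0, t1] -> `|c q - s| < eta m ->
    `|avg (sigma s) (G (c q)) - avg (sigma s) (G s)| <= m.+1%:R^-1.
  move=> sT qs; apply: normr_avgB_le => //; try exact: slice_continuous.
  by move=> v Uv; apply: (heta m).2.
rewrite [X in measurable X](_ : _ = \bigcup_m \bigcup_q
    ([set` `]c q - eta m, c q + eta m[] `&`
      (`[0, t1] `&` [set s | a + m.+1%:R^-1 < avg (sigma s) (G (c q))]))).
  apply: bigcupT_measurable => m; apply: bigcupT_measurable_rat => q.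
  apply: measurableI; first exact: measurable_itv_lebesgue.
  by apply: measurable_avg_gt => //; exact: slice_continuous.
apply/seteqP; split => s /=.
  move=> [sT]; rewrite in_itv/= andbT => asG.
  have [m hm] : exists m : nat, m.+1%:R^-1 < (avg (sigma s) (G s) - a) / 2.
    have : 0 < (avg (sigma s) (G s) - a) / 2 by rewrite divr_gt0// subr_gt0.
    move=> d0; have [m _ /(_ m (leqnn m)) hm] := near_infty_natSinv_lt (PosNum d0).
    by exists m.
  have [|q] := @rat_in_itvoo _ (s - eta m) s.
    by rewrite ltrBlDr ltrDl; exact: (heta m).1.
  rewrite in_itv/= => /andP[sq qs].
  have /andP[s0 st1] : 0 <= s <= t1 by move: sT; rewrite in_itv.
  have cqE : c q = Num.max 0 (ratr q).
    by rewrite /c (min_idPr _)// (le_trans (ltW qs)).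
  have cqs : `|c q - s| < eta m.
    have [e0 _] := heta m.
    rewrite cqE distrC ger0_norm ?subr_ge0 ?ge_max ?s0 ?(ltW qs)//.
    by rewrite ltrBlDr -ltrBlDl lt_max sq orbT.
  exists m => //; exists q => //; split.
    by rewrite /= in_itv/= -ltr_distlC.
  split=> //; have := close _ _ _ sT cqs; rewrite ler_norml => /andP[+ _].
  by move: hm => /=; move: (m.+1%:R^-1) => e; clear; lra.
move=> [m _ [q _ [/=]]]; rewrite in_itv/= -ltr_distlC => cqs [sT asG].
split=> //; rewrite in_itv/= andbT.
have := close _ _ _ sT cqs; rewrite ler_norml => /andP[_].
by move: asG; move: (m.+1%:R^-1) => e; clear; lra.
Qed.

(** The map sending v to the Dirac mass at v is continuous from U to the weak
    topology.  So the preimage of a weakly open set under the relaxed control is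
    the preimage under u of a relatively open, hence Borel, subset of U. *)
Lemma dirac_control_relaxed (t1 : R) U (u : R -> U) : compact U ->
  pure_controls t1 U u -> relaxed_controls t1 U (dirac_control u).
Proof.
move=> cU mu.
have mT : measurable ([set` `[0, t1]] : set (lebesgueType R)).
  exact: measurable_itv_lebesgue.
suff : <<s @weak_open _ _ U >> `<=`
    image_set_system `[0, t1] (dirac_control u)
      (@measurable _ (lebesgueType R) `&` [set A | A `<=` `[0, t1]]).
  by move=> H B /H[].
apply: smallest_sub.
  apply: sigma_algebra_image; split => [|A [mA AT]|F mF].
  - by split; [exact: measurable0|exact: sub0set].
  - by split; [exact: measurableD|exact: subDsetl].
  - split; first by apply: bigcupT_measurable => k; exact: (mF k).1.
    by apply: bigcup_sub => k _; exact: (mF k).2.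
move=> B [W oW WB]; split; last exact: subIsetl.
pose ev (w : 'rV[R]_p) : {ptws set_type (bounded_continuous_on U) -> R} :=
  fun g : set_type (bounded_continuous_on U) => (set_val g) w.
have cev : {within U, continuous ev}.
  move=> x; apply/cvg_sup => g; move: x.
  apply/(@continuousP _ (initial_topology (@^~ g))) => A [C oC <-].
  rewrite -[_ @^-1` _]/((set_val g : 'rV[R]_p -> R) @^-1` C).
  by apply: open_comp => // x _; have [+ _] := set_valP g; exact.
have oB : open (ev @^-1` W : set (subspace U)).
  by apply: open_comp => // x _; exact: cev.
rewrite [X in measurable X](_ : _ = `[0, t1] `&`
    (fun t : R => set_val (u t) : borelType R p) @^-1` (U `&` ev @^-1` W)).
  by apply: mu => //; exact: relatively_open_measurable.
apply/seteqP; split => t /= [tT].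
  rewrite -WB /= => Ot; split=> //; split; first exact: set_valP.
  congr (W _): Ot; apply/funext => g; rewrite /weak_ev.
  by apply: (@avg_dirac _ _ U) => //; have [] := set_valP g.
move=> [_ Ot]; split=> //; rewrite -WB /=.
congr (W _): Ot; apply/funext => g; rewrite /weak_ev; apply/esym.
by apply: (@avg_dirac _ _ U) => //; have [] := set_valP g.
Qed.

End measurability_along_controls.

(** * Continuity on subsets and mean values in several variables *)

Section within_composition.
Context {T S V W : topologicalType}.

Lemma within_comp (A : set T) (B : set S) (k : T -> S) (g : S -> V) :
  {within A, continuous k} -> (forall x, A x -> B (k x)) ->
  {within B, continuous g} -> {within A, continuous (fun x => g (k x))}.
Proof.
move=> /subspace_continuousP ck kAB /subspace_continuousP cg.
apply/subspace_continuousP => x Ax P nP.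
have gP : nbhs (k x) [set y | B y -> P (g y)] := cg _ (kAB _ Ax) _ nP.
have kP : nbhs x [set y | A y -> [set z | B z -> P (g z)] (k y)] := ck _ Ax _ gP.
by apply: filterS kP => y kPy Ay; exact/kPy/kAB.
Qed.

Lemma within_pair (A : set T) (k : T -> S) (l : T -> V) :
  {within A, continuous k} -> {within A, continuous l} ->
  {within A, continuous (fun x => (k x, l x))}.
Proof.
by move=> ck cl x; apply: cvg_pair; [exact: ck|exact: cl].
Qed.

End within_composition.

Lemma within_sum_continuous (R : realType) (T : topologicalType) (A : set T) (I : finType)
    (g : I -> T -> R) :
  (forall i, {within A, continuous (g i)}) ->
  {within A, continuous (fun z => \sum_i g i z)}.
Proof.
move=> cg; elim: (index_enum I) => [|i r cr].
  by under eq_fun do rewrite big_nil; exact: cst_continuous.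
under eq_fun do rewrite big_cons.
by move=> x; apply: cvgD; [exact: cg|exact: cr].
Qed.

Section row_norm.
Context {R : realType} {n : nat}.
Implicit Types v : 'rV[R]_n.

Lemma coord_norm_le v i : `|v 0 i| <= `|v|.
Proof.
rewrite [leRHS]/Num.norm/= mx_normrE.
by apply: (@le_bigmax _ _ _ 0 (fun ij : 'I_1 * 'I_n => `|v ij.1 ij.2|) (0, i)).
Qed.

Lemma rV_norm_le v c : 0 <= c -> (forall i, `|v 0 i| <= c) -> `|v| <= c.
Proof.
move=> c0 vc; rewrite [leLHS]/Num.norm/= mx_normrE.
by apply/bigmax_leP; split => // -[i j] _ /=; rewrite ord1.
Qed.

Lemma coord_within_continuous {T : topologicalType} (A : set T)
    (x : T -> 'rV[R]_n) i :
  {within A, continuous x} -> {within A, continuous (fun t => x t 0 i)}.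
Proof.
move=> cx; apply: (within_comp (g := fun v : 'rV[R]_n => v 0 i) cx (B := setT)).
  by [].
exact/continuous_subspaceT/coord_continuous.
Qed.

Lemma row_within_continuous {T : topologicalType} (A : set T)
    (x : T -> 'rV[R]_n) :
  (forall i, {within A, continuous (fun t => x t 0 i)}) ->
  {within A, continuous x}.
Proof.
move=> cx; apply/within_continuousP => t At e e0.
have e2 : 0 < e / 2 by rewrite divr_gt0.
have : \forall s \near t, forall i, A s -> `|x t 0 i - x s 0 i| < e / 2.
  by apply: filter_forall => i; have /within_continuousP := cx i; exact.
apply: filterS => s hs As; apply: (@le_lt_trans _ _ (e / 2)).
  apply: rV_norm_le => [|i]; first exact: ltW.
  by rewrite !mxE; exact/ltW/hs.
by rewrite ltr_pdivrMr// ltr_pMr// ltr1n.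
Qed.

End row_norm.

Section mean_value.
Context {R : realType} {n : nat}.

Lemma mean_value_between (g dg : R -> R) (a b : R) :
  (forall x : R, is_derive x 1 g (dg x)) ->
  exists2 c, `|c - a| <= `|b - a| & g b - g a = dg c * (b - a).
Proof.
move=> gdg.
have cg (s t : R) : {within `[s, t], continuous g}.
  by apply: derivable_within_continuous => x _; exact: ex_derive.
have [ab|/ltW ba] := leP a b.
  have [c] := MVT_segment ab (fun x _ => gdg x) (cg a b).
  rewrite in_itv/= => /andP[ac cb] E; exists c => //.
  by rewrite !ger0_norm ?subr_ge0// lerD2r.
have [c] := MVT_segment ba (fun x _ => gdg x) (cg b a).
rewrite in_itv/= => /andP[bc ca] E; exists c.
  by rewrite !ler0_norm ?subr_le0// lerN2 lerD2r.
by rewrite -opprB E -mulrN opprB.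
Qed.

(** Moving from x to y one coordinate at a time reduces the increment to one
    variable, so that partial derivatives suffice.  The intermediate points stay
    in the ball of radius |y - x| because the norm is the sup norm. *)
Lemma mean_value_row (F : 'rV[R]_n -> R) (x y : 'rV[R]_n) :
  (forall i z, derivable F z (delta_mx 0 i)) ->
  exists2 xi : 'I_n -> 'rV[R]_n, (forall i, `|xi i - x| <= `|y - x|) &
    F y - F x = \sum_i 'D_(delta_mx 0 i) F (xi i) * (y 0 i - x 0 i).
Proof.
move=> dF; pose z k : 'rV[R]_n := \row_j if (j < k)%N then y 0 j else x 0 j.
have step (k : 'I_n) : exists2 xi : 'rV[R]_n, `|xi - x| <= `|y - x| &
    F (z k.+1) - F (z k) = 'D_(delta_mx 0 k) F xi * (y 0 k - x 0 k).
  set e := delta_mx 0 k.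
  pose g r := F (z k + r *: e).
  have dg (r : R) : is_derive r (1:R) g ('D_e F (z k + r *: e)).
    have E : (fun h : R => h^-1 *: (g (h *: (1:R) + r) - g r)) =
        (fun h => h^-1 *: (F (h *: e + (z k + r *: e)) - F (z k + r *: e))).
      apply/funext => h; congr (_ *: (F _ - _)).
      by rewrite [h *: 1]mulr1 scalerDl addrCA.
    have := dF k (z k + r *: e); rewrite /derivable -/e -E => cg.
    by apply: DeriveDef => //; rewrite /derive -E.
  have [r rle gE] := mean_value_between 0 (y 0 k - x 0 k) dg.
  exists (z k + r *: e).
    apply: rV_norm_le => // j; rewrite !mxE eqxx/=.
    have [->|jk] := eqVneq j k.
      rewrite ltnn mulr1 addrAC subrr add0r; move: rle; rewrite !subr0.
      by move=> /le_trans; apply; have := coord_norm_le (y - x) k; rewrite !mxE.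
    rewrite mulr0 addr0; case: ifP => _; last by rewrite subrr normr0.
    by have := coord_norm_le (y - x) j; rewrite !mxE.
  move: gE; rewrite /g scale0r addr0 subr0 => <-; congr (F _ - _).
  apply/rowP => j; rewrite !mxE eqxx/= ltnS leq_eqVlt.
  have [->|jk] := eqVneq j k.
    by rewrite eqxx/= ltnn mulr1 addrC subrK.
  by rewrite (inj_eq val_inj) (negbTE jk)/= mulr0 addr0.
have /choice[xi hxi] : forall k : 'I_n, exists xi : 'rV[R]_n,
    `|xi - x| <= `|y - x| /\
    F (z k.+1) - F (z k) = 'D_(delta_mx 0 k) F xi * (y 0 k - x 0 k).
  by move=> k; have [xi] := step k; exists xi.
exists xi => [i|]; first by have [] := hxi i.
have -> : F y = F (z n) by congr F; apply/rowP => j; rewrite mxE ltn_ord.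
have -> : F x = F (z 0%N) by congr F; apply/rowP => j; rewrite mxE.
rewrite -(telescope_sumr (fun k => F (z k)) (leq0n n)) big_mkord.
by apply: eq_bigr => k _; have [] := hxi k.
Qed.

End mean_value.

(** * The chain rule along an integral curve *)

Section chain_rule.
Context {R : realType} {n : nat}.
Variables (t1 : R) (L : R -> 'rV[R]_n -> R).

(** The mean value theorem only looks at interior times, where restricting the
    increments to [0, t1] does not change the limit of the quotients. *)
Lemma mean_value_time (x : 'rV[R]_n) (s t : R) :
  {within `[0, t1] `*` setT, continuous (fun z => L z.1 z.2)} ->
  continuously_differentiable t1 L ->
  0 <= s -> s <= t -> t <= t1 ->
  exists2 r, r \in `[s, t] & L t x - L s x = partial_time t1 L r x * (t - s).
Proof.
move=> cL [dtime _ _ _] s0 st tt1.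
apply: (@MVT_segment _ (L ^~ x) ((partial_time t1 L) ^~ x)) => //; last first.
  apply: (within_comp (B := `[0, t1]%classic `*` setT)
    (k := fun r => (r, x)) _ _ cL).
    apply: within_pair; last exact: cst_continuous.
    by apply: continuous_subspaceT => ?; exact: cvg_id.
  by move=> r /=; rewrite !in_itv/= => /andP[? ?]; split=> //; apply/andP; split; lra.
move=> r; rewrite in_itv/= => /andP[sr rt].
have rT : r \in `[0, t1] by rewrite in_itv/=; apply/andP; split; lra.
have cvgq : time_quotient L r x @ 0^' --> partial_time t1 L r x.
  apply: cvg_trans (dtime r x rT) => P nP.
  have near0 : \forall h \near 0^', r + h \in `[0, t1].
    near=> h.
    have hr : `|h| < Num.min (r - s) (t - r).
      by near: h; apply: dnbhs0_lt; rewrite lt_min !subr_gt0 sr rt.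
    move: hr; rewrite lt_min !ltr_norml in_itv/= => /andP[/andP[? ?] /andP[? ?]].
    by apply/andP; split; lra.
  by apply: filterS2 near0 nP => h /= hT; exact.
have E : (fun h : R => h^-1 *: (L (h *: (1:R) + r) x - L r x)) =
    time_quotient L r x.
  by apply/funext => h; rewrite /time_quotient [h *: 1]mulr1 [h + r]addrC.
apply: DeriveDef; rewrite /derivable /derive E; last exact: cvg_lim.
by apply/cvg_ex; eexists; exact: cvgq.
Unshelve. all: by end_near. Qed.

Definition total_derivative (x a : R -> 'rV[R]_n) (r : R) : R :=
  partial_time t1 L r (x r) + \sum_i partial_space L i r (x r) * a r 0 i.

Lemma along_trajectory (F : R -> 'rV[R]_n -> R) (x : R -> 'rV[R]_n) :
  {within `[0, t1] `*` setT, continuous (fun z => F z.1 z.2)} ->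
  {within `[0, t1], continuous x} ->
  {within `[0, t1], continuous (fun r => F r (x r))}.
Proof.
move=> cF cx.
apply: (within_comp (B := `[0, t1]%classic `*` setT) (k := fun r => (r, x r)) _ _ cF).
  by apply: within_pair => //; apply: continuous_subspaceT => ?; exact: cvg_id.
by [].
Qed.

Lemma bounded_measurable_total_derivative (x a : R -> 'rV[R]_n) :
  continuously_differentiable t1 L ->
  {within `[0, t1], continuous x} ->
  (forall i, bounded_measurable t1 (fun s => a s 0 i)) ->
  bounded_measurable t1 (total_derivative x a).
Proof.
move=> [_ _ ctime cspace] cx ma; apply: bounded_measurableD.
  apply: bounded_measurable_continuous.
  exact: (@along_trajectory (partial_time t1 L)).
apply: bounded_measurable_sum => i; apply: (bounded_measurableM _ (ma i)).
apply: bounded_measurable_continuous.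
exact: (@along_trajectory (partial_space L i)).
Qed.

(** The curve x is the integral of a merely measurable velocity a, so it need not
    be differentiable at a given time.  Instead, near each time c the increment
    of L t (x t) and the integral of its total derivative are both compared with
    ct (t - s) + sum cs i (x t - x s) i, where the partial derivatives are
    frozen at (c, x c).  Continuity of the partial derivatives makes both errors
    small relative to t - s, so [locally_flat_constant] applies to the
    difference. *)
Lemma chain_rule (x a : R -> 'rV[R]_n) :
  {within `[0, t1] `*` setT, continuous (fun z => L z.1 z.2)} ->
  continuously_differentiable t1 L ->
  {within `[0, t1], continuous x} ->
  (forall i, bounded_measurable t1 (fun s => a s 0 i)) ->
  (forall s t i, 0 <= s -> s <= t -> t <= t1 ->
     x t 0 i - x s 0 i = \int[leb]_(r in `]s, t]) a r 0 i) ->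
  forall s t, 0 <= s -> s <= t -> t <= t1 ->
    L t (x t) - L s (x s) = \int[leb]_(r in `]s, t]) total_derivative x a r.
Proof.
move=> cL C1 cx ma xa s t s0 st tt1.
have mD := bounded_measurable_total_derivative C1 cx ma.
pose D := total_derivative x a.
suff H : L t (x t) - \int[leb]_(r in `[0, t]) D r =
    L s (x s) - \int[leb]_(r in `[0, s]) D r.
  by move: H (Rintegral_split mD s0 st tt1); rewrite -/D; clear; lra.
apply: (@locally_flat_constant _ t1
  (fun t => L t (x t) - \int[leb]_(r in `[0, t]) D r)) => //.
move=> c cT e e0; have [_ dspace ctime cspace] := C1.
have /choice[A hA] : forall i, exists A : R, 0 <= A /\
    forall s, s \in `[0, t1] -> `|a s 0 i| <= A.
  by move=> i; have [_ [A]] := ma i; exists A.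
pose B := 1 + \sum_i A i.
have A0 i : 0 <= A i by have [] := hA i.
have B0 : 0 < B by rewrite ltr_pwDl// sumr_ge0.
(* B bounds 1 plus the speed of x in the l^1 norm; each of the two errors below
   is at most d B (t - s), half of e (t - s) *)
pose d := e / (2 * B).
have d0 : 0 < d by rewrite divr_gt0// mulr_gt0.
pose ct := partial_time t1 L c (x c).
pose cs i := partial_space L i c (x c).
have [rho rho0 hrho] : exists2 rho, 0 < rho & forall r z, r \in `[0, t1] ->
    `|c - r| < rho -> `|x c - z| < rho ->
    `|partial_time t1 L r z - ct| <= d /\
    (forall i, `|partial_space L i r z - cs i| <= d).
  have : \forall z \near (c, x c), (`[0, t1]%classic `*` setT) z ->
     `|partial_time t1 L z.1 z.2 - ct| <= d /\
     (forall i, `|partial_space L i z.1 z.2 - cs i| <= d).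
    have /within_continuousP/(_ (c, x c) (conj cT I) _ d0) := ctime.
    have : \forall z \near (c, x c), forall i, (`[0, t1]%classic `*` setT) z ->
        `|partial_space L i c (x c) - partial_space L i z.1 z.2| < d.
      apply: (filter_forall (nbhs_filter (c, x c))) => i.
      by have /within_continuousP/(_ (c, x c) (conj cT I) _ d0) := cspace i.
    apply: filterS2 => z hs ht zT; split; first by rewrite distrC ltW// ht.
    by move=> i; rewrite distrC ltW// hs.
  move=> [[P Q]/= [/nbhs_ballP[r1 /= r10 hP] /nbhs_ballP[r2 /= r20 hQ]] PQ].
  exists (Num.min r1 r2); first by rewrite lt_min r10.
  move=> r z rT; rewrite !lt_min => /andP[cr _] /andP[_ xz].
  apply: (PQ (r, z)) => /=; last by split.
  by split; [exact: hP|apply: hQ => /=; rewrite -ball_normE].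
have [r1 r10 hr1] : exists2 r1, 0 < r1 & forall r, r \in `[0, t1] ->
    `|c - r| < r1 -> `|x c - x r| < rho / 3.
  have rho3 : 0 < rho / 3 by rewrite divr_gt0.
  have /within_continuousP/(_ c cT _ rho3)[r1 /= r10 H] := cx.
  by exists r1 => // r rT cr; exact: H.
exists (Num.min rho r1); first by rewrite lt_min rho0.
move=> {s t s0 st tt1} s t s0 st tt1; rewrite !lt_min.
move=> /andP[scrho scr1] /andP[tcrho tcr1].
have sT : s \in `[0, t1] by rewrite in_itv/= s0 (le_trans st).
have tT : t \in `[0, t1] by rewrite in_itv/= tt1 (le_trans s0).
have xs : `|x c - x s| < rho / 3 by apply: hr1 => //; rewrite distrC.
have xt : `|x c - x t| < rho / 3 by apply: hr1 => //; rewrite distrC.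
have rho3 : rho / 3 < rho by rewrite ltr_pdivrMr// ltr_pMr// ltr1n.
have between r : r \in `[s, t] -> r \in `[0, t1] /\
    `|c - r| < rho /\ `|c - r| < r1.
  rewrite !in_itv/= => /andP[sr rt]; split.
    by rewrite (le_trans s0 sr) (le_trans rt tt1).
  move: scrho scr1 tcrho tcr1; rewrite !ltr_norml.
  move=> /andP[s1 s2] /andP[s3 s4] /andP[t2 t3] /andP[t4 t5].
  split; apply/andP; split.
  - by move: t3 rt; clear; lra.
  - by move: s1 sr; clear; lra.
  - by move: t5 rt; clear; lra.
  - by move: s3 sr; clear; lra.
pose inc i := x t 0 i - x s 0 i.
have incE i : inc i = \int[leb]_(r in `]s, t]) a r 0 i by exact: xa.
have incA i : `|inc i| <= A i * (t - s).
  rewrite incE; apply: (normr_Rintegral_oc_le (ma i) s0 st tt1) => r rst.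
  exact/(hA i).2/(sub_horizon s0 tt1).
pose I0 := \int[leb]_(r in `[0, s]) D r.
have frozen_L : `|L t (x t) - L s (x s) - (ct * (t - s) + \sum_i cs i * inc i)|
    <= d * B * (t - s).
  have [r rst rE] := mean_value_time (x t) cL C1 s0 st tt1.
  have [xi hxi xiE] := mean_value_row (x s) (x t) (fun i z => dspace i s z sT).
  have -> : L t (x t) - L s (x s) - (ct * (t - s) + \sum_i cs i * inc i) =
      (partial_time t1 L r (x t) - ct) * (t - s) +
      \sum_i (partial_space L i s (xi i) - cs i) * inc i.
    rewrite mulrBl -rE.
    under [X in _ = _ + X]eq_bigr do rewrite mulrBl.
    rewrite sumrB -[X in _ = _ + (X - _)]xiE.
    by move: (\sum_i _) => S; clear; lra.
  have -> : d * B * (t - s) = d * (t - s) + \sum_i d * (A i * (t - s)).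
    rewrite /B [d * _]mulrDr mulr1 mulrDl mulr_sumr mulr_suml; congr (_ + _).
    by apply: eq_bigr => i _; rewrite mulrA.
  rewrite (le_trans (ler_normD _ _))// lerD//.
    rewrite normrM [`|t - s|]ger0_norm ?subr_ge0// ler_wpM2r ?subr_ge0//.
    have [rT [crho _]] := between _ rst.
    by have [] := hrho r (x t) rT crho (lt_trans xt rho3).
  rewrite (le_trans (ler_norm_sum _ _ _))// ler_sum// => i _.
  rewrite normrM ler_pM// ?incA//.
  have [|//|_] := hrho s (xi i) sT; first by rewrite distrC.
    rewrite (le_lt_trans (ler_distD (x s) _ _))//.
    rewrite [`|x s - _|]distrC.
    rewrite (le_lt_trans (lerD (ltW xs) (hxi i)))//.
    rewrite (le_lt_trans (lerD (lexx _) (ler_distD (x c) _ _)))//.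
    by move: xs xt; rewrite [`|x t - _|]distrC; clear; lra.
  exact.
have frozen_D : `|\int[leb]_(r in `]s, t]) D r -
    (ct * (t - s) + \sum_i cs i * inc i)| <= d * B * (t - s).
  pose C r := ct + \sum_i cs i * a r 0 i.
  have mcs i : bounded_measurable t1 (fun r => cs i * a r 0 i).
    exact: bounded_measurableM (bounded_measurable_cst _ _) (ma i).
  have mS := bounded_measurable_sum mcs.
  have mC : bounded_measurable t1 C.
    exact: bounded_measurableD (bounded_measurable_cst _ _) mS.
  have -> : ct * (t - s) + \sum_i cs i * inc i = \int[leb]_(r in `]s, t]) C r.
    rewrite (Rintegral_ocD (bounded_measurable_cst _ ct) mS s0 tt1).
    rewrite Rintegral_oc_cst// (Rintegral_oc_sum mcs s0 st tt1); congr (_ + _).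
    by apply: eq_bigr => i _; rewrite (Rintegral_ocZ _ (ma i) s0 tt1) incE.
  rewrite -(Rintegral_ocB mD mC s0 tt1).
  apply: (normr_Rintegral_oc_le (bounded_measurableB mD mC) s0 st tt1) => r rst.
  have [rT [crho cr1]] := between r (subset_itv_oc_cc rst).
  have [hct hcs] := hrho r (x r) rT crho (lt_trans (hr1 _ rT cr1) rho3).
  have -> : D r - C r = (partial_time t1 L r (x r) - ct) +
      \sum_i (partial_space L i r (x r) - cs i) * a r 0 i.
    rewrite /D /C /total_derivative.
    under [X in _ = _ + X]eq_bigr do rewrite mulrBl.
    by rewrite sumrB opprD addrACA.
  rewrite (le_trans (ler_normD _ _))// /B [d * _]mulrDr mulr1 mulr_sumr lerD//.
  rewrite (le_trans (ler_norm_sum _ _ _))// ler_sum// => i _.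
  by rewrite normrM ler_pM//; exact: (hA i).2.
rewrite (Rintegral_split mD s0 st tt1) -/D -/I0.
have dB : d * B = e / 2.
  by rewrite /d; field; rewrite gt_eqF.
move: frozen_L frozen_D; rewrite dB.
move: (\int[leb]_(r in `]s, t]) D r) (ct * (t - s) + _) => ID F.
move=> h1 h2.
have -> : L t (x t) - (I0 + ID) - (L s (x s) - I0) =
  (L t (x t) - L s (x s) - F) - (ID - F) by clear; lra.
rewrite (le_trans (ler_normB _ _))// (le_trans (lerD h1 h2))//.
by rewrite -mulrDl -splitr.
Qed.

End chain_rule.

(** * The cutoff and the smoothed maximum of a function *)

Section cutoff.
Context {R : realType}.
Variables (phi : R -> R).
Hypothesis phiP : phi_admissible phi.

Lemma clamp01_lip (a b : R) :
  `|Num.max 0 (Num.min 1 a) - Num.max 0 (Num.min 1 b)| <= `|a - b|.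
Proof.
wlog ab : a b / a <= b.
  by move=> H; case: (leP a b) => [|/ltW] /H//; rewrite distrC [leRHS]distrC.
rewrite [leRHS]ler0_norm ?subr_le0// ler_norml.
by case: (leP 1 a) => ?; case: (leP 1 b) => ?; rewrite ?(max_r ler01);
  case: (leP 0 a) => ?; case: (leP 0 b) => ?; apply/andP; split; lra.
Qed.

Lemma clamp01_itv (a : R) : Num.max 0 (Num.min 1 a) \in `[0, 1].
Proof. by rewrite in_itv/= le_max lexx/= ge_max ler01/= ge_min lexx. Qed.

(** In this form the bounds and the Lipschitz constant of phi on [0, 1] pass to
    psi on the whole line, because truncation to [0, 1] is 1-Lipschitz. *)
Lemma psi_clamp delta d : 0 < delta ->
  psi phi delta d = phi (Num.max 0 (Num.min 1 (1 + d / delta))).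
Proof.
move=> d0; have [_ phi0 phi1 _ _] := phiP; rewrite /psi.
case: (ltP 0 d) => [dpos|dneg].
  have : 0 < d / delta by rewrite divr_gt0.
  by move=> ?; rewrite min_l ?max_r//; lra.
case: (ltP d (- delta)) => [dd|dd].
  have : d / delta < -1 by rewrite ltr_pdivrMr// mulN1r.
  move=> ?; have -> : Num.min 1 (1 + d / delta) = 1 + d / delta.
    by rewrite min_r//; lra.
  by rewrite max_l//; lra.
have : -1 <= d / delta by rewrite ler_pdivlMr// mulN1r.
have : d / delta <= 0 by rewrite pmulr_lle0// invr_gt0.
move=> ? ?; have -> : Num.min 1 (1 + d / delta) = 1 + d / delta.
  by rewrite min_r//; lra.
by rewrite max_r//; lra.
Qed.

Lemma psi_itv delta d : 0 < delta -> 0 <= psi phi delta d <= 1.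
Proof.
move=> d0; have [phi01 _ _ _ _] := phiP; rewrite psi_clamp//.
by have := phi01 _ (clamp01_itv (1 + d / delta)); rewrite in_itv.
Qed.

Lemma psi_lip delta : 0 < delta ->
  exists2 l, 0 < l & forall a b,
    `|psi phi delta a - psi phi delta b| <= l * `|a - b|.
Proof.
move=> d0; have [_ _ _ _ [M [_ hM]]] := phiP.
pose k := `|M| + 1; have k0 : 0 < k by rewrite ltr_wpDl.
exists (k / delta) => [|a b]; first by rewrite divr_gt0.
rewrite !psi_clamp//.
have Mk : M < k by rewrite /k ltr_pwDr// ler_norm.
have := hM _ Mk (Num.max 0 (Num.min 1 (1 + a / delta)),
                 Num.max 0 (Num.min 1 (1 + b / delta))).
move=> /(_ (conj (clamp01_itv _) (clamp01_itv _))) /= /le_trans; apply.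
rewrite -mulrA ler_wpM2l ?(ltW k0)// (le_trans (clamp01_lip _ _))//.
rewrite opprD addrACA subrr add0r -mulrBl normrM mulrC.
by rewrite [`|delta^-1|]ger0_norm// invr_ge0 ltW.
Qed.

Lemma psi_comp_continuous (T delta : R) (h y : R -> R) : 0 < delta ->
  {within `[0, T], continuous h} -> {within `[0, T], continuous y} ->
  {within `[0, T], continuous (fun s => psi phi delta (h s - y s))}.
Proof.
move=> d0 ch cy; apply/within_continuousP => t tT e e0.
have [l l0 hl] := psi_lip d0.
have cB : {within `[0, T], continuous (fun s => h s - y s)}.
  by move=> s; apply: cvgB; [exact: ch|exact: cy].
have el : 0 < e / l by rewrite divr_gt0.
have /within_continuousP/(_ _ tT _ el) := cB.
apply: filterS => s hs sT; rewrite (le_lt_trans (hl _ _))//.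
by rewrite mulrC -ltr_pdivlMr//; exact: hs.
Qed.

End cutoff.

Section sandwich.
Context {R : realType}.

(** The time tau is the supremum of the times in [0, t] at which d is not
    positive; by continuity it is one of them. *)
Lemma last_time (T : R) (d : R -> R) t :
  {within `[0, T], continuous d} -> d 0 <= 0 -> 0 <= t -> t <= T ->
  exists2 tau, 0 <= tau <= t & d tau <= 0 /\ forall s, s \in `]tau, t] -> 0 < d s.
Proof.
move=> cd d0 t0 tT; pose S := [set s | s \in `[0, t] /\ d s <= 0].
have S0 : S 0 by split => //; rewrite in_itv/= lexx.
have ubS : ubound S t by move=> s [+ _]; rewrite in_itv/= => /andP[].
have supS : has_sup S by split; [exists 0|exists t].
have tau0 : 0 <= sup S by apply: ub_le_sup => //; exists t.
have taut : sup S <= t by apply: ge_sup => //; exists 0.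
exists (sup S); first by rewrite tau0.
split; last first.
  move=> s; rewrite in_itv/= => /andP[ts st]; rewrite ltNge; apply/negP => ds.
  have : s <= sup S.
    apply: ub_le_sup; first by exists t.
    by split => //; rewrite in_itv/= st andbT (le_trans tau0)// ltW.
  by rewrite leNgt ts.
rewrite leNgt; apply/negP => dtau.
have tauT : `[0, T]%classic (sup S) by rewrite /= in_itv/= tau0 (le_trans taut).
have /within_continuousP/(_ _ tauT _ dtau)[r /= r0 hr] := cd.
have [s [sT ds] rs] := sup_adherent r0 supS.
have stau : s <= sup S by apply: ub_le_sup; [exists t|].
have /hr : `|sup S - s| < r by rewrite ger0_norm ?subr_ge0//; lra.
have sT' : `[0, T]%classic s.
  by move: sT; rewrite /= !in_itv/= => /andP[-> /le_trans->].
by move=> /(_ sT') /ltr_normlW; lra.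
Qed.

(* In the application h is Lmx along a trajectory, D the average of Delta_mx and
   A the average of its positive part. *)
Variables (T delta : R) (phi h y A D : R -> R).
Hypothesis phiP : phi_admissible phi.
Hypothesis delta_gt0 : 0 < delta.
Hypothesis ch : {within `[0, T], continuous h}.
Hypothesis cy : {within `[0, T], continuous y}.
Hypothesis mA : bounded_measurable T A.
Hypothesis A_ge0 : forall s, s \in `[0, T] -> 0 <= A s.
Hypothesis mD : bounded_measurable T D.
Hypothesis DA : forall s, s \in `[0, T] -> D s <= A s.
Hypothesis hD : forall s t, 0 <= s -> s <= t -> t <= T ->
  h t - h s = \int[leb]_(r in `]s, t]) D r.
Hypothesis yE : forall t, t \in `[0, T] ->
  y t = h 0 + \int[leb]_(s in `[0, t]) (psi phi delta (h s - y s) * A s).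

Let v s := psi phi delta (h s - y s) * A s.

Let mv : bounded_measurable T v.
Proof.
apply: (bounded_measurableM _ mA); apply: bounded_measurable_continuous.
exact: psi_comp_continuous.
Qed.

Let y_increment s t : 0 <= s -> s <= t -> t <= T ->
  y t - y s = \int[leb]_(r in `]s, t]) v r.
Proof.
move=> s0 st tT.
rewrite !yE ?in_itv/= ?s0 ?(le_trans s0 st) ?(le_trans st tT)//.
by move: (Rintegral_split mv s0 st tT); rewrite -/v; lra.
Qed.

Let y0 : 0 <= T -> y 0 = h 0.
Proof.
move=> T0; rewrite yE ?in_itv/= ?lexx// (Rintegral_oc0 mv) ?lexx//.
by rewrite set_itv_ge ?bnd_simp// Rintegral_set0 addr0.
Qed.

Lemma nondecreasing_smooth_max s t : 0 <= s -> s <= t -> t <= T -> y s <= y t.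
Proof.
move=> s0 st tT; rewrite -subr_ge0 y_increment//; apply: Rintegral_ge0 => r rst.
rewrite mulr_ge0 ?A_ge0//; first by case/andP: (psi_itv phiP (h r - y r) delta_gt0).
exact: (sub_horizon s0 tT).
Qed.

(** After the last time with h <= y the cutoff equals 1, so from then on y grows at
    least as fast as h and cannot have been overtaken. *)
Lemma le_smooth_max t : 0 <= t -> t <= T -> h t <= y t.
Proof.
move=> t0 tT; have T0 := le_trans t0 tT.
have cd : {within `[0, T], continuous (fun s => h s - y s)}.
  by move=> s; apply: cvgB; [exact: ch|exact: cy].
have [|tau /andP[tau0 taut] [dtau hpos]] := last_time cd _ t0 tT.
  by rewrite y0// subrr.
have hy : h t - h tau <= y t - y tau.
  rewrite hD// y_increment//; apply: (le_Rintegral_oc mD mv tau0 tT) => r rt.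
  by rewrite /v /psi hpos// mul1r DA//; exact: (sub_horizon tau0 tT).
by move: hy dtau; lra.
Qed.

(** After the last time with y <= M + delta the cutoff vanishes, since h <= M, so y
    stays constant from then on. *)
Lemma smooth_max_le M t : 0 <= t -> t <= T ->
  (forall s, s \in `[0, t] -> h s <= M) -> y t <= M + delta.
Proof.
move=> t0 tT hM; have T0 := le_trans t0 tT.
have cd : {within `[0, T], continuous (fun s => y s - (M + delta))}.
  by move=> s; apply: cvgB; [exact: cy|exact: cst_continuous].
have [|tau /andP[tau0 taut] [dtau hpos]] := last_time cd _ t0 tT.
  have : h 0 <= M by apply: hM; rewrite in_itv/= lexx.
  by rewrite y0//; move: delta_gt0; lra.
suff : y t - y tau = 0 by move: dtau; lra.
rewrite y_increment//; transitivity (\int[leb]_(r in `]tau, t]) (0 : R)).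
  2: by rewrite Rintegral_oc_cst// mul0r.
apply: eq_Rintegral => r /set_mem/= rt; rewrite /v /psi.
have hr : h r <= M.
  by apply: hM; move: rt; rewrite !in_itv/= => /andP[/ltW/(le_trans tau0)-> ->].
have yr := hpos _ rt.
have below : h r - y r < - delta by lra.
have nonpos : (0 < h r - y r) = false.
  by apply/negbTE; rewrite -leNgt (le_trans (ltW below))// oppr_le0 ltW.
by rewrite nonpos below mul0r.
Qed.

End sandwich.

(** * Existence of states and of smoothed maxima *)

Section euclidean_norm.
Context {R : realType} {n : nat}.
Implicit Types v : 'rV[R]_n.

Lemma coord_le_enorm v i : `|v 0 i| <= enorm v.
Proof.
rewrite -sqrtr_sqr /enorm ler_wsqrtr// (bigD1 i)//= lerDl sumr_ge0// => j _.
exact: sqr_ge0.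
Qed.

(** The factor n + 1 instead of the square root of n stays positive for n = 0, as
    the Lipschitz constants built from it must. *)
Lemma enorm_le v : enorm v <= n.+1%:R * `|v|.
Proof.
have nv0 : 0 <= n.+1%:R * `|v| by rewrite mulr_ge0.
rewrite -[leRHS]ger0_norm// -sqrtr_sqr /enorm ler_wsqrtr//.
apply: (@le_trans _ _ (\sum_(i < n) `|v| ^+ 2)).
  apply: ler_sum => i _; rewrite -[leLHS]ger0_norm ?sqr_ge0// normrX.
  by rewrite lerXn2r ?nnegrE// coord_norm_le.
rewrite sumr_const card_ord -[_ *+ n]mulr_natl exprMn ler_wpM2r ?sqr_ge0//.
by rewrite -natrX ler_nat (leq_trans (leqnSn n))// -{1}(expn1 n.+1) leq_pexp2l.
Qed.

End euclidean_norm.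

Section trajectories.
Context {R : realType} {n p : nat}.
Variables (t1 : R) (U : set 'rV[R]_p).

(** Inserting a trajectory turns the data of the problem into integrands of the
    form required by [bounded_measurable_avg]. *)
Lemma frozen_trajectory_continuous (F : R -> 'rV[R]_n -> 'rV[R]_p -> R)
    (x : R -> 'rV[R]_n) :
  {within `[0, t1] `*` setT `*` U,
    continuous (fun z : R * 'rV[R]_n * 'rV[R]_p => F z.1.1 z.1.2 z.2)} ->
  {within `[0, t1], continuous x} ->
  {within `[0, t1] `*` U, continuous (fun z => F z.1 (x z.1) z.2)}.
Proof.
move=> cF cx.
have c1 : {within `[0, t1] `*` U, continuous (fun z : R * 'rV[R]_p => z.1)}.
  by apply: continuous_subspaceT => z; exact: cvg_fst.
have c2 : {within `[0, t1] `*` U, continuous (fun z : R * 'rV[R]_p => z.2)}.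
  by apply: continuous_subspaceT => z; exact: cvg_snd.
apply: (within_comp (B := `[0, t1]%classic `*` setT `*` U)
  (k := fun z : R * 'rV[R]_p => (z.1, x z.1, z.2)) _ _ cF).
  apply: within_pair => //; apply: within_pair => //.
  by apply: (within_comp (B := `[0, t1]%classic) c1 _ cx) => z [].
by move=> z [].
Qed.

Lemma control_slice_continuous (F : R -> 'rV[R]_n -> 'rV[R]_p -> R) s x :
  {within `[0, t1] `*` setT `*` U,
    continuous (fun z : R * 'rV[R]_n * 'rV[R]_p => F z.1.1 z.1.2 z.2)} ->
  s \in `[0, t1] -> {within U, continuous (F s x)}.
Proof.
move=> cF sT.
apply: (within_comp (B := `[0, t1]%classic `*` setT `*` U)
  (k := fun v : 'rV[R]_p => (s, x, v)) _ _ cF).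
  apply: within_pair; first exact: cst_continuous.
  by apply: continuous_subspaceT => ?; exact: cvg_id.
by [].
Qed.

End trajectories.

Section solutions.
Context {R : realType} {n p : nat}.
Variables (t1 : R) (U : set 'rV[R]_p).
Variable f : R -> 'rV[R]_n -> 'rV[R]_p -> 'rV[R]_n.
Variable x0 : 'rV[R]_n.
Hypothesis t1_gt0 : 0 < t1.
Hypothesis cU : compact U.
Hypothesis cf : {within `[0, t1] `*` setT `*` U,
  continuous (fun z : R * 'rV[R]_n * 'rV[R]_p => f z.1.1 z.1.2 z.2)}.

Lemma coord_f_continuous i : {within `[0, t1] `*` setT `*` U,
  continuous (fun z : R * 'rV[R]_n * 'rV[R]_p => f z.1.1 z.1.2 z.2 0 i)}.
Proof.
exact: coord_within_continuous.
Qed.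

Lemma velocity_continuous i (x : R -> 'rV[R]_n) :
  {within `[0, t1], continuous x} ->
  {within `[0, t1] `*` U, continuous (fun z => f z.1 (x z.1) z.2 0 i)}.
Proof.
move=> cx.
exact: (frozen_trajectory_continuous (F := fun s x v => f s x v 0 i)
  (@coord_f_continuous i)).
Qed.

Lemma bounded_measurable_velocity i (sigma : R -> Prob U)
    (x : R -> 'rV[R]_n) :
  relaxed_controls t1 U sigma -> {within `[0, t1], continuous x} ->
  bounded_measurable t1 (fun s => avg (sigma s) (fun v => f s (x s) v 0 i)).
Proof.
move=> msigma cx.
exact: (bounded_measurable_avg (G := fun s v => f s (x s) v 0 i)
  t1_gt0 cU msigma (velocity_continuous cx)).
Qed.

(** Averaging preserves the Lipschitz bound of f, so [volterra_contraction] makes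
    the Picard operator a contraction.  The bound is given in the Euclidean norm
    and used in the sup norm, which costs the factor n + 1. *)
Lemma state_solution_exists (sigma : R -> Prob U) :
  (exists2 Kf : R, 0 < Kf & forall s v, s \in `[0, t1] -> U v ->
      forall x x', enorm (f s x v - f s x' v) <= Kf * enorm (x - x')) ->
  relaxed_controls t1 U sigma ->
  exists x, state_solution t1 f x0 sigma x.
Proof.
move=> [Kf Kf0 lipf] msigma.
pose K := Kf * n.+1%:R; have K0 : 0 < K by rewrite mulr_gt0.
pose Phi (x : R -> 'rV[R]_n) t := x0 + \row_i \int[leb]_(s in `[0, t])
  avg (sigma s) (fun v => f s (x s) v 0 i).
pose w s := expR (2 * K * s).
have lipfi s v x y i : s \in `[0, t1] -> U v ->
    `|f s x v 0 i - f s y v 0 i| <= K * `|x - y|.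
  move=> sT Uv; have := coord_le_enorm (f s x v - f s y v) i.
  rewrite !mxE => /le_trans; apply; apply: (le_trans (lipf _ _ sT Uv x y)).
  by rewrite -mulrA ler_wpM2l ?enorm_le// ltW.
have [|||x cx xE] := @weighted_fixed_point _ _ `[0, t1]%classic w
  (expR (2 * K * t1)) Phi (@segment_compact _ _ _).
- move=> t; rewrite /= in_itv/= => /andP[t0 tt1]; rewrite /w.
  have K2 : 0 <= 2 * K by rewrite mulr_ge0// ltW.
  apply/andP; split; first by rewrite -[leLHS]expR0 ler_expR mulr_ge0.
  by rewrite ler_expR ler_wpM2l.
- move=> x cx; apply: row_within_continuous => i.
  rewrite (_ : (fun t => Phi x t 0 i) = fun t => x0 0 i + \int[leb]_(s in `[0, t])
      avg (sigma s) (fun v => f s (x s) v 0 i)).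
    by apply: continuous_primitive; exact: bounded_measurable_velocity.
  by apply/funext => t; rewrite !mxE.
- move=> x y C C0 cx cy xy t tT.
  apply: rV_norm_le => [|i]; first by rewrite mulr_ge0 ?divr_ge0 ?expR_ge0.
  rewrite !mxE opprD addrACA subrr add0r /w.
  apply: (volterra_contraction K0 (bounded_measurable_velocity i msigma cx)
    (bounded_measurable_velocity i msigma cy) _ C0 tT) => s sT.
  have cxs := slice_continuous (G := fun s v => f s (x s) v 0 i)
    (velocity_continuous cx) sT.
  have cys := slice_continuous (G := fun s v => f s (y s) v 0 i)
    (velocity_continuous cy) sT.
  apply: (normr_avgB_le _ cU cxs cys) => v Uv.
  rewrite (le_trans (lipfi _ _ _ _ _ sT Uv))//.
  by rewrite ler_wpM2l ?xy// ltW.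
exists x; split => // t tT; exact: xE.
Qed.

Lemma state_is_solution (sigma : R -> Prob U) :
  (exists x, state_solution t1 f x0 sigma x) ->
  state_solution t1 f x0 sigma (state t1 f x0 sigma).
Proof.
move=> [x hx]; rewrite /state.
exact: (@xgetPex _ (cst x0) [set x | state_solution t1 f x0 sigma x]
  (ex_intro _ x hx)).
Qed.

End solutions.

Section smoothed_maximum.
Context {R : realType}.
Variables (T : R) (phi : R -> R).
Hypothesis phiP : phi_admissible phi.

(** As psi is l-Lipschitz and |A| <= M, the right-hand side is Lipschitz in y with
    constant l M; l (M + 1) is used because it is positive. *)
Lemma smooth_max_exists delta (c : R) (h A : R -> R) : 0 < delta ->
  {within `[0, T], continuous h} -> bounded_measurable T A ->
  exists2 y, {within `[0, T], continuous y} & forall t, t \in `[0, T] ->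
    y t = c + \int[leb]_(s in `[0, t]) (psi phi delta (h s - y s) * A s).
Proof.
move=> d0 ch mA; have [_ [M M0 hM]] := mA.
have [l l0 hl] := psi_lip phiP d0.
pose K := l * (M + 1); have K0 : 0 < K by rewrite mulr_gt0// ltr_wpDl.
pose w s := expR (2 * K * s).
have mv y : {within `[0, T], continuous y} ->
    bounded_measurable T (fun s => psi phi delta (h s - y s) * A s).
  move=> cy; apply: (bounded_measurableM _ mA).
  by apply: bounded_measurable_continuous; exact: psi_comp_continuous.
apply: (@weighted_fixed_point _ _ `[0, T]%classic w (expR (2 * K * T))
  (fun y t => c + \int[leb]_(s in `[0, t]) (psi phi delta (h s - y s) * A s))
  (@segment_compact _ _ _)).
- move=> t; rewrite /= in_itv/= => /andP[t0 tT]; rewrite /w.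
  have K2 : 0 <= 2 * K by rewrite mulr_ge0// ltW.
  apply/andP; split; first by rewrite -[leLHS]expR0 ler_expR mulr_ge0.
  by rewrite ler_expR ler_wpM2l.
- by move=> y cy; apply: continuous_primitive; exact: mv.
- move=> y z C C0 cy cz yz t tT; rewrite opprD addrACA subrr add0r /w.
  apply: (volterra_contraction K0 (mv _ cy) (mv _ cz) _ C0 tT) => s sT.
  rewrite -mulrBl normrM.
  apply: (@le_trans _ _ (l * (C * w s) * (M + 1))); last first.
    by rewrite /K mulrAC.
  apply: ler_pM => //; last by rewrite (le_trans (hM _ sT))// lerDl.
  rewrite (le_trans (hl _ _))// ler_wpM2l ?(ltW l0)//.
  have -> : h s - y s - (h s - z s) = z s - y s by ring.
  by rewrite distrC; exact: yz.
Qed.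

End smoothed_maximum.

(** * The smoothing error of the payoff *)

Section smoothing_error.
Context {R : realType} {n p : nat}.
Variables (t1 : R) (U : set 'rV[R]_p).
Variable f : R -> 'rV[R]_n -> 'rV[R]_p -> 'rV[R]_n.
Variable Lr : R -> 'rV[R]_n -> 'rV[R]_p -> R.
Variable Lmx : R -> 'rV[R]_n -> R.
Variable Psi : 'rV[R]_n -> R.
Variable x0 : 'rV[R]_n.
Variable phi : R -> R.
Hypothesis t1_gt0 : 0 < t1.
Hypothesis phiP : phi_admissible phi.
Hypothesis cU : compact U.
Hypothesis cf : {within `[0, t1] `*` setT `*` U,
  continuous (fun z : R * 'rV[R]_n * 'rV[R]_p => f z.1.1 z.1.2 z.2)}.
Hypothesis lipf : exists2 Kf : R, 0 < Kf & forall s v, s \in `[0, t1] -> U v ->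
  forall x x', enorm (f s x v - f s x' v) <= Kf * enorm (x - x').
Hypothesis cLmx : {within `[0, t1] `*` setT,
  continuous (fun z : R * 'rV[R]_n => Lmx z.1 z.2)}.
Hypothesis C1 : continuously_differentiable t1 Lmx.

Lemma Delta_mx_pos_continuous : {within `[0, t1] `*` setT `*` U,
  continuous (fun z : R * 'rV[R]_n * 'rV[R]_p =>
    Num.max (Delta_mx t1 f Lmx z.1.1 z.1.2 z.2) 0)}.
Proof.
have [_ _ ctime cspace] := C1.
have lift (F : R -> 'rV[R]_n -> R) :
    {within `[0, t1] `*` setT, continuous (fun z => F z.1 z.2)} ->
    {within `[0, t1] `*` setT `*` U,
      continuous (fun z : R * 'rV[R]_n * 'rV[R]_p => F z.1.1 z.1.2)}.
  move=> cF; apply: (within_comp (B := `[0, t1]%classic `*` setT)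
    (k := fun z : R * 'rV[R]_n * 'rV[R]_p => z.1) _ _ cF) => [|z []//].
  by apply: continuous_subspaceT => z; exact: cvg_fst.
apply: (within_comp (B := setT) (g := fun d : R => Num.max d 0)) => //; last first.
  apply: continuous_subspaceT => d; apply: continuous_max; first exact: cvg_id.
  exact: cvg_cst.
move=> z; apply: cvgD; first exact: (lift _ ctime).
apply: within_sum_continuous => i {}z.
apply: cvgM; first exact: (lift _ (cspace i)).
exact: coord_f_continuous.
Qed.

Section one_control.
Variable sigma : R -> Prob U.
Hypothesis msigma : relaxed_controls t1 U sigma.

Let x := state t1 f x0 sigma.
Let h s := Lmx s (x s).
Let A s := avg (sigma s) (fun v => Num.max (Delta_mx t1 f Lmx s (x s) v) 0).
Let a s : 'rV[R]_n := \row_i avg (sigma s) (fun v => f s (x s) v 0 i).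
Let D := total_derivative t1 Lmx x a.

Let xP : state_solution t1 f x0 sigma x.
Proof. exact/state_is_solution/state_solution_exists. Qed.

Let cx : {within `[0, t1], continuous x}. Proof. by have [] := xP. Qed.

Let ch : {within `[0, t1], continuous h}.
Proof. exact: (along_trajectory (F := Lmx)). Qed.

Let mA : bounded_measurable t1 A.
Proof.
apply: (bounded_measurable_avg
  (G := fun s v => Num.max (Delta_mx t1 f Lmx s (x s) v) 0) t1_gt0 cU msigma).
exact: (frozen_trajectory_continuous
  (F := fun s y v => Num.max (Delta_mx t1 f Lmx s y v) 0)
  Delta_mx_pos_continuous cx).
Qed.

Let A_ge0 s : 0 <= A s.
Proof. by apply: avg_ge0 => v _; rewrite le_max lexx orbT. Qed.

Let ma i : bounded_measurable t1 (fun s => a s 0 i).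
Proof.
apply: (@bounded_measurable_eq _ _
  (fun s => avg (sigma s) (fun v => f s (x s) v 0 i))).
  by move=> s _; rewrite mxE.
exact: bounded_measurable_velocity.
Qed.

Let x_increment s t i : 0 <= s -> s <= t -> t <= t1 ->
  x t 0 i - x s 0 i = \int[leb]_(r in `]s, t]) a r 0 i.
Proof.
move=> s0 st tt1; have [_ xE] := xP.
have coord r : r \in `[0, t1] ->
    x r 0 i = x0 0 i + \int[leb]_(q in `[0, r]) a q 0 i.
  by move=> /xE ->; rewrite !mxE; under [in RHS]eq_Rintegral do rewrite mxE.
rewrite !coord ?in_itv/= ?s0 ?(le_trans s0 st) ?(le_trans st tt1)//.
rewrite (Rintegral_split (ma i) s0 st tt1).
by rewrite opprD addrACA subrr add0r addrAC subrr add0r.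
Qed.

Let mD : bounded_measurable t1 D.
Proof. exact: bounded_measurable_total_derivative. Qed.

Let h_increment s t : 0 <= s -> s <= t -> t <= t1 ->
  h t - h s = \int[leb]_(r in `]s, t]) D r.
Proof. exact: chain_rule. Qed.

Let DA s : s \in `[0, t1] -> D s <= A s.
Proof.
move=> sT.
have cfi i : {within U, continuous (fun v => f s (x s) v 0 i)}.
  apply: (control_slice_continuous (F := fun s y v => f s y v 0 i) _ sT).
  exact: coord_f_continuous.
have cfZ i : {within U,
    continuous (fun v => partial_space Lmx i s (x s) * f s (x s) v 0 i)}.
  by move=> v; apply: cvgM; [exact: cvg_cst|exact: cfi].
have cS := within_sum_continuous cfZ.
have cc : {within U, continuous (fun _ : 'rV[R]_p => partial_time t1 Lmx s (x s))}.
  exact: cst_continuous.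
have -> : D s = avg (sigma s) (Delta_mx t1 f Lmx s (x s)).
  rewrite /D /total_derivative /Delta_mx avgD// avg_cst// avg_sum//.
  by congr (_ + _); apply: eq_bigr => i _; rewrite avgZ// mxE.
apply: le_avg => //.
- by move=> v; apply: cvgD; [exact: cc|exact: cS].
- apply: (control_slice_continuous
    (F := fun s y v => Num.max (Delta_mx t1 f Lmx s y v) 0) _ sT).
  exact: Delta_mx_pos_continuous.
- by move=> v _; rewrite le_max lexx.
Qed.

Let x_init : x 0 = x0.
Proof.
apply/rowP => i; have [_ xE] := xP.
rewrite xE ?in_itv/= ?lexx ?ltW// !mxE.
have mv := bounded_measurable_velocity t1_gt0 cU cf i msigma cx.
rewrite (Rintegral_oc0 mv) ?lexx ?ltW//.
by rewrite set_itv_ge ?bnd_simp// Rintegral_set0 addr0.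
Qed.

(** The function h s = Lmx s (x s) is a primitive of the average of Delta_mx, by
    [chain_rule], and the smoothed maximum is driven by the average of the
    positive part of Delta_mx, which is larger.  So [le_smooth_max] and
    [smooth_max_le] apply, and monotonicity of y turns a bound on h into a bound
    on its running maximum.  The error delta does not depend on sigma. *)
Lemma max_state_bounds delta : 0 < delta ->
  max_state t1 f Lmx x0 phi 0 sigma t1 <=
    max_state t1 f Lmx x0 phi delta sigma t1 <=
    max_state t1 f Lmx x0 phi 0 sigma t1 + delta.
Proof.
move=> d0; rewrite /max_state eqxx gt_eqF//.
set y := xget _ _.
have [cy yE] : smooth_max_solution t1 f Lmx x0 phi delta sigma y.
  have [y' cy' y'E] := smooth_max_exists phiP (Lmx 0 x0) d0 ch mA.
  exact: (@xgetPex _ _ [set y | smooth_max_solution t1 f Lmx x0 phi delta sigma y]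
    (ex_intro _ y' (conj cy' y'E))).
have yE' t : t \in `[0, t1] -> y t = h 0 + \int[leb]_(s in `[0, t])
    (psi phi delta (h s - y s) * A s).
  by move=> tT; rewrite /h x_init; exact: yE.
have t10 := ltW t1_gt0.
have A0 s (_ : s \in `[0, t1]) := A_ge0 s.
rewrite /running_max -/x.
set S := [set _ | _ in _].
have S0 : S (h 0) by exists 0 => //=; rewrite in_itv/= lexx.
have ubS : ubound S (y t1).
  move=> _ [s /= + <-]; rewrite in_itv/= => /andP[s0 st1].
  apply: (@le_trans _ _ (y s)).
    exact: (le_smooth_max phiP d0 ch cy mA mD DA h_increment yE').
  exact: (nondecreasing_smooth_max phiP d0 ch cy mA A0 yE').
apply/andP; split; first by apply: ge_sup => //; exists (h 0).
apply: (smooth_max_le phiP d0 ch cy mA yE') => // s sT.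
by apply: ub_le_sup; [exists (y t1)|exists s].
Qed.

Lemma Gamma_bounds delta : 0 < delta ->
  Gamma t1 f Lr Lmx Psi x0 phi sigma delta <=
    Gamma t1 f Lr Lmx Psi x0 phi sigma 0 <=
    Gamma t1 f Lr Lmx Psi x0 phi sigma delta + delta.
Proof.
move=> /max_state_bounds /andP[lo hi]; rewrite /Gamma.
by apply/andP; split; [rewrite lerD2l lerN2|rewrite -[leRHS]addrA lerD2l; lra].
Qed.

End one_control.

(** Averaging over a Dirac mass is evaluation, so the two integral equations have
    the same set of solutions, from which both sides select by [xget]. *)
Lemma state_dirac (u : R -> U) :
  state t1 f x0 (dirac_control u) = pure_state t1 f x0 u.
Proof.
rewrite /state /pure_state; congr xget; apply/funext => x; apply/propext.
suff E t i : t \in `[0, t1] ->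
    \int[leb]_(s in `[0, t])
      avg (dirac_control u s) (fun v => f s (x s) v 0 i) =
    \int[leb]_(s in `[0, t]) f s (x s) (set_val (u s)) 0 i.
  split=> -[cx xE]; split=> // t tT; rewrite xE//; congr (_ + _);
    by apply/rowP => i; rewrite !mxE E.
rewrite in_itv/= => /andP[t0 tt1].
apply: eq_Rintegral => s /set_mem/=; rewrite in_itv/= => /andP[s0 st].
have sT : s \in `[0, t1] by rewrite in_itv/= s0 (le_trans st).
apply: (@avg_dirac _ _ U (u s) (fun v => f s (x s) v 0 i)) => //.
apply: (control_slice_continuous (F := fun s y v => f s y v 0 i) _ sT).
exact: coord_f_continuous.
Qed.

Lemma Gamma_dirac (u : R -> U) :
  {within `[0, t1] `*` setT `*` U,
    continuous (fun z : R * 'rV[R]_n * 'rV[R]_p => Lr z.1.1 z.1.2 z.2)} ->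
  Gamma t1 f Lr Lmx Psi x0 phi (dirac_control u) 0 =
  J t1 f Lr Lmx Psi x0 u.
Proof.
move=> cLr; rewrite /Gamma /J /max_state eqxx /running_max state_dirac.
congr (_ + _ - _); apply: eq_Rintegral => s /set_mem/= sT.
apply: (@avg_dirac _ _ U (u s) (Lr s (pure_state t1 f x0 u s))) => //.
exact: (control_slice_continuous cLr sT).
Qed.

End smoothing_error.

(** * Convergence of the optimal smooth controls *)

Theorem theorem4 (R : realType) (n p : nat) (t1 : R) (U : set 'rV[R]_p)
    (f : R -> 'rV[R]_n -> 'rV[R]_p -> 'rV[R]_n)
    (Lr : R -> 'rV[R]_n -> 'rV[R]_p -> R)
    (Lmx : R -> 'rV[R]_n -> R) (Psi : 'rV[R]_n -> R)
    (x0 : 'rV[R]_n) (phi : R -> R)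
    (t1_gt0 : 0 < t1)
    (phiP : phi_admissible phi)
    (A0 : compact U)
    (A1_continuous :
      {within `[0, t1] `*` setT `*` U,
        continuous (fun z : R * 'rV[R]_n * 'rV[R]_p => f z.1.1 z.1.2 z.2)})
    (A1 : exists2 Kf : R, 0 < Kf & forall (s : R) v, s \in `[0, t1] -> U v ->
      (forall x x', enorm (f s x v - f s x' v) <= Kf * enorm (x - x')) /\
      (forall x, enorm (f s x v) <= Kf * (1 + enorm x)))
    (A2_Lr : {within `[0, t1] `*` setT `*` U,
      continuous (fun z : R * 'rV[R]_n * 'rV[R]_p => Lr z.1.1 z.1.2 z.2)})
    (A2_Lmx : {within `[0, t1] `*` setT,
      continuous (fun z : R * 'rV[R]_n => Lmx z.1 z.2)})
    (A2_Psi : continuous Psi)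
    (A2 : exists KL : R, forall s : R, s \in `[0, t1] ->
      forall x x', `|Lmx s x - Lmx s x'| <= KL * enorm (x - x'))
    (A3_C1 : continuously_differentiable t1 Lmx)
    (A3 : exists2 KD : R, 0 < KD & forall (s : R) v, s \in `[0, t1] -> U v ->
      (forall x x', `|Delta_mx t1 f Lmx s x v - Delta_mx t1 f Lmx s x' v|
                      <= KD * enorm (x - x')) /\
      (forall x, `|Delta_mx t1 f Lmx s x v| <= KD * (1 + enorm x)))
    (A4 : forall (s : R) x, s \in `[0, t1] ->
      convex_set ([set f s x v | v in U] : set (convex_lmodType 'rV[R]_n)))
    (A5 : exists2 Kr : R, 0 < Kr & forall (s : R) v, s \in `[0, t1] -> U v ->
      (forall x x', `|Lr s x v - Lr s x' v| <= Kr * enorm (x - x')) /\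
      (forall x, `|Lr s x v| <= Kr * (1 + enorm x)))
    (delta : nat -> R)
    (delta_gt0 : forall k, 0 < delta k)
    (delta_cvg : delta k @[k --> \oo] --> (0 : R))
    (u : nat -> R -> U)
    (u_pure : forall k, pure_controls t1 U (u k))
    (u_optimal_pure : forall k,
      (Gamma t1 f Lr Lmx Psi x0 phi (dirac_control (u k)) (delta k))%:E
      = pure_Gamma_star t1 U f Lr Lmx Psi x0 phi (delta k))
    (u_optimal_relaxed : forall k,
      (Gamma t1 f Lr Lmx Psi x0 phi (dirac_control (u k)) (delta k))%:E
      = Gamma_star t1 U f Lr Lmx Psi x0 phi (delta k)) :
  `|(Gamma t1 f Lr Lmx Psi x0 phi (dirac_control (u k)) 0)%:E
    - Gamma_star t1 U f Lr Lmx Psi x0 phi 0|%E @[k --> \oo] --> (0 : \bar R)%E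
  /\
  forall k, Gamma t1 f Lr Lmx Psi x0 phi (dirac_control (u k)) 0
            = J t1 f Lr Lmx Psi x0 (u k).
Proof.
split; last by move=> k; exact: Gamma_dirac.
have lipf : exists2 Kf : R, 0 < Kf & forall s v, s \in `[0, t1] -> U v ->
    forall x x', enorm (f s x v - f s x' v) <= Kf * enorm (x - x').
  by have [Kf Kf0 H] := A1; exists Kf => // s v sT /(H s v sT)[].
pose g (sigma : R -> Prob U) (d : R) : R := Gamma t1 f Lr Lmx Psi x0 phi sigma d.
have bounds sigma d : relaxed_controls t1 U sigma -> 0 < d ->
    g sigma d <= g sigma 0 <= g sigma d + d.
  by move=> msigma d0; exact: Gamma_bounds.
have mu k := dirac_control_relaxed A0 (u_pure k).
pose gs := Gamma_star t1 U f Lr Lmx Psi x0 phi 0.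
have lo k : ((g (dirac_control (u k)) 0)%:E <= gs)%E.
  by apply: ereal_sup_ubound; exists (dirac_control (u k)).
have hi k : (gs <= (g (dirac_control (u k)) 0 + delta k)%:E)%E.
  apply: ge_ereal_sup => _ [sigma msigma <-]; rewrite lee_fin.
  have /andP[_ b1] := bounds _ _ msigma (delta_gt0 k).
  have /andP[b2 _] := bounds _ _ (mu k) (delta_gt0 k).
  have b3 : g sigma (delta k) <= g (dirac_control (u k)) (delta k).
    have : ((g sigma (delta k))%:E <= Gamma_star t1 U f Lr Lmx Psi x0 phi (delta k))%E.
      by apply: ereal_sup_ubound; exists sigma.
    by rewrite -(u_optimal_relaxed k) lee_fin.
  by apply: (le_trans b1); rewrite lerD2r; exact: (le_trans b3 b2).
have gs_fin : gs \is a fin_num.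
  rewrite fin_numElt (lt_le_trans _ (lo 0%N)) ?ltNyr//=.
  by rewrite (le_lt_trans (hi 0%N)) ?ltry.
rewrite -/gs -(fineK gs_fin).
have lo' k : g (dirac_control (u k)) 0 <= fine gs.
  by rewrite -lee_fin fineK.
have hi' k : fine gs <= g (dirac_control (u k)) 0 + delta k.
  by rewrite -lee_fin fineK.
apply: cvg_EFin; first exact: nearW.
apply: (@squeeze_cvgr _ _ _ _ (cst 0) delta) => //; last exact: cvg_cst.
apply: nearW => k /=; rewrite normr_ge0/= -/(g _ _).
by rewrite ler0_norm ?subr_le0// opprB lerBlDl.
Qed.
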